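(* Let $N\ge 3$, $k\in(0,N-1)$, $p>0$, and let $\mu\not\equiv 0$ be a positive Radon measure on $\mathbb R^N$ with support contained in the open half space $\mathbb R^N_+$ and whose Newtonian potential $U^\mu$ is finite at every point of $\mathbb R^N$. Consider the problem $$-\Delta u=\mu \text{ in }\mathbb R^N_+,\qquad \frac{\partial u}{\partial n}(x',0)=\lambda\int_{\mathbb R^{N-1}}\frac{u(y',0)^p}{|x'-y'|^k}\,dy' \text{ on }\partial\mathbb R^N_+, \tag{P}$$ with positive solutions understood in the sense defined in the context. Then: (i) If either $0<k\le 1$ and $p>0$, or $1<k<N-1$ and $0<p<\frac{N-1}{k-1}$, then for every $\lambda>0$ problem (P) has no positive solution. (ii) If $1<k<N-1$ and $p=\frac{N-1}{k-1}$, then for every $\lambda>0$ problem (P) has no positive solution $u$ with $u(\cdot,0)\in L^p(\mathbb R^{N-1})$. (iii) If $1<k<N-1$, $p>\frac{N-1}{k-1}$, and there is a constant $C(N,\mu)>0$ with $$U^\mu(x)\le C(N,\mu)(1+|x|)^{1-k}\quad\text{for a.e. }x\in\mathbb R^N,$$ then there exists $\lambda^*>0$ such that for every $0<\lambda<\lambda^*$ problem (P) has a positive solution $u$; moreover $u-\int_{\mathbb R^N_+}G(\cdot,y)\,d\mu(y)\in C^{0,\gamma}(\overline{\mathbb R^N_+})$ for some $\gamma\in(0,1)$.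
   Context: Notation: $\mathbb R^N_+=\mathbb R^{N-1}\times(0,\infty)$, points $x=(x',x_N)$ with $x'\in\mathbb R^{N-1}$; $\partial\mathbb R^N_+=\mathbb R^{N-1}\times\{0\}$; $n=(0,\dots,0,-1)$ so $\frac{\partial u}{\partial n}(x',0)=-\frac{\partial u}{\partial x_N}(x',0)$. $\sigma_N$ is the surface area of the unit sphere in $\mathbb R^N$. The Newtonian potential of a measure $\nu$ is $U^\nu(x)=\frac{1}{(N-2)\sigma_N}\int_{\mathbb R^N}\frac{d\nu(y)}{|x-y|^{N-2}}$. Let $\Phi(x)=\frac{1}{(N-2)\sigma_N}|x|^{2-N}$, $\overline x=(x',-x_N)$, and $G(x,y)=\Phi(x-y)+\Phi(\overline x-y)$ for $x,y\in\overline{\mathbb R^N_+}$ (Neumann Green function of $-\Delta$ in $\mathbb R^N_+$). For a function $u$ define $H_u(x')=\int_{\mathbb R^{N-1}}\frac{u(y',0)^p}{|x'-y'|^k}dy'$. Definition (positive solution of (P)): a measurable $u$ such that (a) $u>0$ a.e. in $\mathbb R^N_+$ and for a.e. $x'\in\mathbb R^{N-1}$ the limit $\lim_{z\in\mathbb R^N_+,\,z\to(x',0)}u(z)$ exists and is finite, and is denoted $u(x',0)$; (b) $H_u$ is finite a.e. in $\mathbb R^{N-1}$ and $\int_{\mathbb R^{N-1}}\frac{H_u(y')}{|x-(y',0)|^{N-2}}dy'<\infty$ for a.e. $x\in\mathbb R^N_+$; (c) for a.e. $x\in\mathbb R^N_+$, $$u(x)=\int_{\mathbb R^N_+}G(x,y)\,d\mu(y)+\frac{2\lambda}{(N-2)\sigma_N}\int_{\mathbb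 R^{N-1}}\int_{\mathbb R^{N-1}}\frac{u(z',0)^p}{|x-(y',0)|^{N-2}|y'-z'|^k}\,dz'\,dy'.$$ *)

(* Defs.v *)
From HB Require Import structures.
From mathcomp Require Import all_boot all_order all_algebra.
From mathcomp Require Import all_classical all_reals all_analysis.
Set Implicit Arguments. Unset Strict Implicit. Unset Printing Implicit Defensive.
Import Order.TTheory GRing.Theory Num.Theory.
Local Open Scope classical_set_scope.
Local Open Scope ring_scope.

(* R^N is represented as R^{N-1} x R : a point x = (x', x_N) is a pair whose
   first component is an (N-1)-tuple of reals.  Measurability is the product
   (= Borel) sigma-algebra provided by MathComp-Analysis on tuples and pairs. *)
Notation pt R N := (((N.-1).-tuple R) * R)%type.

Section defs.
Variable R : realType.

(* Iterated Lebesgue integral over R^n (by Tonelli, the Lebesgue integral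
   over R^n for nonnegative measurable integrands). *)
Fixpoint tint (n : nat) : (n.-tuple R -> \bar R) -> \bar R :=
  match n return (n.-tuple R -> \bar R) -> \bar R with
  | 0 => fun f => f [tuple]
  | m.+1 => fun f =>
      (\int[@lebesgue_measure R]_x tint (fun t : m.-tuple R => f (cons_tuple x t)))%E
  end.

Definition sqdist n (a b : n.-tuple R) : R := \sum_(i < n) (tnth a i - tnth b i) ^+ 2.
Definition tdist n (a b : n.-tuple R) : R := Num.sqrt (sqdist a b).

Variable N : nat.

Definition pdist (x y : pt R N) : R := Num.sqrt (sqdist x.1 y.1 + (x.2 - y.2) ^+ 2).
Definition pnorm (x : pt R N) : R := Num.sqrt (\sum_(i < N.-1) tnth x.1 i ^+ 2 + x.2 ^+ 2).

Definition intRN (f : pt R N -> \bar R) : \bar R :=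
  tint (fun x' => (\int[@lebesgue_measure R]_t f (x', t))%E).

Definition nullRn n (A : set (n.-tuple R)) : Prop :=
  exists B, measurable B /\ A `<=` B /\ tint (fun x => ((\1_B x : R))%:E) = 0%E.
Definition nullRN (A : set (pt R N)) : Prop :=
  exists B, measurable B /\ A `<=` B /\ intRN (fun x => ((\1_B x : R))%:E) = 0%E.

Definition ae_Rn (P : (N.-1).-tuple R -> Prop) : Prop := nullRn [set x | ~ P x].
Definition ae_RN (P : pt R N -> Prop) : Prop := nullRN [set x | ~ P x].
Definition ae_RNp (P : pt R N -> Prop) : Prop := nullRN [set x | 0 < x.2 /\ ~ P x].

Definition halfspace : set (pt R N) := [set x | 0 < x.2].

(* sigma_N = surface area of the unit sphere = N * |B_1| *)
Definition sigmaN : R :=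
  N%:R * fine (intRN (fun x => ((\1_[set y | pnorm y < 1] x : R))%:E)).

Definition Phi (x y : pt R N) : \bar R :=
  if x == y then +oo%E
  else ((((N - 2)%:R * sigmaN)^-1 * (pdist x y ^+ (N - 2))^-1))%:E.

Definition reflect_pt (x : pt R N) : pt R N := (x.1, - x.2).

Definition Green (x y : pt R N) : \bar R := (Phi x y + Phi (reflect_pt x) y)%E.

Definition Upot (mu : {measure set (pt R N) -> \bar R}) (x : pt R N) : \bar R :=
  (\int[mu]_y Phi x y)%E.

Definition in_support (mu : {measure set (pt R N) -> \bar R}) (x : pt R N) : Prop :=
  forall r, 0 < r -> (0 < mu [set y | (pdist x y < r)%R])%E.
Definition locally_finite (mu : {measure set (pt R N) -> \bar R}) : Prop :=
  forall r, 0 < r -> (mu [set y | (pnorm y < r)%R] < +oo)%E.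

Definition kerk (k : R) (y z : (N.-1).-tuple R) : \bar R :=
  if y == z then +oo%E else ((tdist y z `^ k)^-1)%:E.

Definition kerN (x : pt R N) (y : (N.-1).-tuple R) : \bar R :=
  if x == (y, 0) then +oo%E else ((pdist x (y, 0) ^+ (N - 2))^-1)%:E.

Definition Hu (k p : R) (ut : (N.-1).-tuple R -> R) (x : (N.-1).-tuple R) : \bar R :=
  tint (fun y => ((ut y `^ p)%:E * kerk k x y)%E).

(* Positive solution of (P); ut is the boundary trace u(.,0). *)
Definition positive_solution (k p lam : R) (mu : {measure set (pt R N) -> \bar R})
    (u : pt R N -> R) (ut : (N.-1).-tuple R -> R) : Prop :=
  (* u is (Lebesgue) measurable on R^N_+ *)
  (exists v : pt R N -> R, measurable_fun setT v /\ ae_RNp (fun x => u x = v x)) /\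
  ae_RNp (fun x => 0 < u x) /\
  ae_Rn (fun x' => forall e, 0 < e -> exists2 d, 0 < d &
           forall z : pt R N, 0 < z.2 -> pdist z (x', 0) < d -> `|u z - ut x'| < e) /\
  ae_Rn (fun x' => (Hu k p ut x' < +oo)%E) /\
  ae_RNp (fun x => (tint (fun y => Hu k p ut y * kerN x y) < +oo)%E) /\
  ae_RNp (fun x => (u x)%:E =
     (\int[mu]_(y in halfspace) Green x y +
      ((2 * lam) / ((N - 2)%:R * sigmaN))%:E *
        tint (fun y => tint (fun z => (ut z `^ p)%:E * kerN x y * kerk k y z)))%E).

Definition holder_closed_half (gam : R) (w : pt R N -> R) : Prop :=
  exists C : R, (forall x : pt R N, 0 <= x.2 -> `|w x| <= C) /\
    (forall x y : pt R N, 0 <= x.2 -> 0 <= y.2 -> `|w x - w y| <= C * pdist x y `^ gam).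

End defs.

(* Main.v *)
Require Import Defs.
From HB Require Import structures.
From mathcomp Require Import all_boot all_order all_algebra.
From mathcomp Require Import all_classical all_reals all_analysis.
From mathcomp Require Import measurable_realfun ring lra.
Import Order.TTheory GRing.Theory Num.Theory.
Import numFieldNormedType.Exports.
Local Open Scope classical_set_scope.
Local Open Scope ring_scope.

(** Write n = N - 1.

    Nonexistence: suppose u(., 0) >= c (1 + |x'|)^-a almost everywhere.  Keeping in
    the boundary integral only z in the cube [rho, 2 rho]^n and y in the cube
    [tau, 2 tau]^n, tau comparable to 1 + |x|, bounds u from below by multiples of
    (1 + |x|)^(1-k) (take rho = 1) and of (1 + |x|)^(n+1-k-ap) (take rho = tau); the
    limit of u at the boundary inherits these bounds.  The measure mu gives the start
    a = N - 2, the first bound then a = k - 1, and for p (k-1) < n the second one lowers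
    a by a fixed amount at each step until a = 0, where H_u is infinite.  In the
    critical case a = k - 1 already contradicts u(., 0) in L^p.

    Existence: choose s < k - 1 with p s > n.  If 0 <= v <= M (1 + |x'|)^-s, then H_v
    is O((1 + |y|)^-k) and its single layer potential is O((1 + |x'|)^-s), both with
    constants proportional to M^p.  For small lambda, Picard iteration from the
    boundary values of the Green potential of mu therefore increases and stays
    bounded, and monotone convergence makes its limit a fixed point. *)

(** * Iterated integrals over R^n *)

(** A trace [ut] is an arbitrary function, known only through bounds off a null set. Lower estimates
    therefore compare integrands with multiples of indicators of cubes minus null sets, which takes
    nothing but monotonicity of the integral. Upper estimates must respect the iterated form of the
    integral, so radial kernels are dominated by tensor products: each |x_i - y_i| is at most |x -
    y|, hence |x - y|^(-a) is at most the product of the |x_i - y_i|^(-a/n). As a < n < b means a/n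
    < 1 < b/n, no integrability is lost. The support of mu lies in the open half space, so every
    boundary point is the centre of a mu-null ball. For y outside it and z near the centre x, the
    ratio of |z - y| to |x - y| is close to 1. This gives both the continuity of the Green potential
    at the boundary and its decay there, although the decay of U^mu is known only almost everywhere.
    In the existence part p s > n lets H_v keep the full decay k of its kernel, and s < k - 1 is the
    integrability margin in the next convolution. *)

Section NonmeasurableIntegral.
Local Open Scope ereal_scope.
Context d (T : measurableType d) (R : realType).
Variable nu : {measure set T -> \bar R}.
Import HBNNSimple.

(* Measurability is not needed: the integral of a nonnegative function is defined
   as a supremum over the simple functions below it. *)
Lemma ge0_integral_mono (D : set T) (f g : T -> \bar R) :
  (forall x, D x -> 0 <= f x) -> (forall x, D x -> f x <= g x) ->
  \int[nu]_(x in D) f x <= \int[nu]_(x in D) g x.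
Proof.
move=> f0 fg.
rewrite !ge0_integralE//; last by move=> x Dx; exact: le_trans (f0 _ Dx) (fg _ Dx).
apply: ereal_sup_le => _ [h hf <-]; exists h => // x; apply: le_trans (hf x) _.
by rewrite /patch; case: ifPn => // /set_mem Dx; exact: fg.
Qed.

End NonmeasurableIntegral.

Section Tint.
Local Open Scope ereal_scope.
Context {R : realType}.

Lemma tint_ge0 n (f : n.-tuple R -> \bar R) : (forall t, 0 <= f t) -> 0 <= tint f.
Proof.
elim: n f => [f f0|n IH f f0] /=; first exact: f0.
by apply: integral_ge0 => x _; exact: IH.
Qed.

Lemma le_tint n (f g : n.-tuple R -> \bar R) :
  (forall t, 0 <= f t) -> (forall t, f t <= g t) -> tint f <= tint g.
Proof.
elim: n f g => [f g f0 fg|n IH f g f0 fg] /=; first exact: fg.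
apply: ge0_integral_mono => x _; first exact: tint_ge0.
exact: IH.
Qed.

Lemma eq_tint n (f g : n.-tuple R -> \bar R) : f =1 g -> tint f = tint g.
Proof. by move=> /funext ->. Qed.

Lemma measurable_cons_tuple n :
  measurable_fun setT (fun z : R * n.-tuple R => cons_tuple z.1 z.2).
Proof.
have := @measurable_cons _ _ _ _ (fst : R * n.-tuple R -> R) n snd.
exact.
Qed.

Lemma measurable_cons_tuple2 n (x : R) :
  measurable_fun setT (fun z : n.-tuple R => cons_tuple x z).
Proof.
have := @measurable_cons _ _ _ _ (fun _ : n.-tuple R => x) n id.
by apply.
Qed.

(** The parameter space [T] is general so that in the induction it can absorb the first coordinate
    of the tuple, which Tonelli then integrates out in dimension one. *)
Lemma measurable_tint d (T : measurableType d) n (f : T * n.-tuple R -> \bar R) :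
  measurable_fun setT f -> (forall z, 0 <= f z) ->
  measurable_fun setT (fun x => tint (fun t => f (x, t))).
Proof.
elim: n d T f => [|n IH] d T f mf f0 /=.
  apply: (measurableT_comp mf); apply: measurable_fun_pair => //.
apply: (@measurable_fun_fubini_tonelli_F _ _ _ _ _ (@lebesgue_measure R)
  (fun z : T * R => tint (fun t => f (z.1, cons_tuple z.2 t)))).
- apply: (IH _ _ (fun z : (T * R) * n.-tuple R => f (z.1.1, cons_tuple z.1.2 z.2))) => //.
  apply: (measurableT_comp mf); apply: measurable_fun_pair.
    by apply: measurableT_comp => //.
  have := @measurable_cons _ _ _ _ (fun z : (T * R) * n.-tuple R => z.1.2) n snd.
  by apply => //; apply: measurableT_comp.
- by move=> z; exact: tint_ge0.
Qed.

Lemma measurable_tint_cons n (f : n.+1.-tuple R -> \bar R) :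
  measurable_fun setT f -> (forall t, 0 <= f t) ->
  measurable_fun setT (fun x => tint (fun t => f (cons_tuple x t))).
Proof.
move=> mf f0; apply: (@measurable_tint _ _ _ (fun z => f (cons_tuple z.1 z.2))) => //.
exact: (measurableT_comp mf (measurable_cons_tuple n)).
Qed.

Lemma measurable_comp_cons n (f : n.+1.-tuple R -> \bar R) x :
  measurable_fun setT f -> measurable_fun setT (fun t => f (cons_tuple x t)).
Proof. by move=> mf; exact: (measurableT_comp mf (measurable_cons_tuple2 n x)). Qed.

Lemma tint0 n : tint (fun _ : n.-tuple R => 0) = 0.
Proof.
elim: n => [//|n IH] /=; under eq_integral do rewrite IH; exact: integral0.
Qed.

Lemma tintD n (f g : n.-tuple R -> \bar R) :
  measurable_fun setT f -> (forall t, 0 <= f t) ->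
  measurable_fun setT g -> (forall t, 0 <= g t) ->
  tint (fun t => f t + g t) = tint f + tint g.
Proof.
elim: n f g => [//|n IH] f g mf f0 mg g0 /=.
rewrite -ge0_integralD//.
- by apply: eq_integral => x _; rewrite IH//; exact: measurable_comp_cons.
- by move=> x _; exact: tint_ge0.
- exact: measurable_tint_cons.
- by move=> x _; exact: tint_ge0.
- exact: measurable_tint_cons.
Qed.

Lemma tintZl n (f : n.-tuple R -> \bar R) k :
  measurable_fun setT f -> (forall t, 0 <= f t) -> 0 <= k ->
  tint (fun t => k * f t) = k * tint f.
Proof.
elim: n f => [//|n IH] f mf f0 k0 /=.
rewrite -ge0_integralZl//.
- by apply: eq_integral => x _; rewrite IH//; exact: measurable_comp_cons.
- exact: measurable_tint_cons.
- by move=> x _; exact: tint_ge0.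
Qed.

Lemma cvg_tint_monotone n (f : nat -> n.-tuple R -> \bar R) (g : n.-tuple R -> \bar R) :
  (forall i, measurable_fun setT (f i)) -> (forall i t, 0 <= f i t) ->
  (forall t, nondecreasing_seq (f ^~ t)) ->
  (forall t, f ^~ t @ \oo --> g t) ->
  tint (f i) @[i --> \oo] --> tint g.
Proof.
elim: n f g => [f g _ _ _ fg|n IH f g mf f0 ndf fg] /=; first exact: fg.
have IHx x : tint (fun t => f i (cons_tuple x t)) @[i --> \oo]
    --> tint (fun t => g (cons_tuple x t)).
  apply: IH => // i; exact: measurable_comp_cons.
rewrite (_ : (fun x => tint (fun t => g (cons_tuple x t))) =
   (fun x => limn (fun i => tint (fun t => f i (cons_tuple x t))))); last first.
  by apply/funext => x; apply/esym/cvg_lim => //; exact: IHx.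
apply: (@cvg_monotone_convergence _ _ _ (@lebesgue_measure R) _ measurableT
  (fun i x => tint (fun t => f i (cons_tuple x t)))) => //.
- by move=> i; exact: measurable_tint_cons.
- by move=> i x _; exact: tint_ge0.
- move=> x _ i j ij; apply: le_tint => // t; exact: ndf.
Qed.

Lemma measurable_bigmule d (T : measurableType d) n (h : 'I_n -> T -> \bar R) :
  (forall i, measurable_fun setT (h i)) ->
  measurable_fun setT (fun x => \big[mule/1]_(i < n) h i x).
Proof.
elim: n h => [h _|n IH h mh].
  by under eq_fun do rewrite big_ord0; exact: measurable_cst.
under eq_fun do rewrite big_ord_recl.
apply: emeasurable_funM; first exact: mh.
by apply: (IH (fun i => h (lift ord0 i))).
Qed.

Lemma bigmule_ge0 n (h : 'I_n -> \bar R) :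
  (forall i, 0 <= h i) -> 0 <= \big[mule/1]_(i < n) h i.
Proof.
elim: n h => [h _|n IH h h0]; first by rewrite big_ord0.
by rewrite big_ord_recl mule_ge0//; exact: IH.
Qed.

(** Every n-dimensional integral evaluated below is reduced to dimension one here: those of cubes
    and those of the majorants of Riesz kernels. *)
Lemma tint_prod n (h : 'I_n -> R -> \bar R) :
  (forall i, measurable_fun setT (h i)) -> (forall i x, 0 <= h i x) ->
  tint (fun t => \big[mule/1]_(i < n) h i (tnth t i)) =
  \big[mule/1]_(i < n) \int[@lebesgue_measure R]_x h i x.
Proof.
elim: n h => [h _ _|n IH h mh h0]; first by rewrite /= !big_ord0.
rewrite big_ord_recl -IH//= -ge0_integralZr//; last 2 first.
- exact: mh.
- by apply: tint_ge0 => t; exact: bigmule_ge0.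
- apply: eq_integral => x _.
  rewrite -tintZl//.
  + by apply: eq_tint => t; rewrite big_ord_recl; congr (_ * _);
      apply: eq_bigr => i _; rewrite tnthS.
  + apply: measurable_bigmule => i.
    exact: (measurableT_comp (mh _) (@measurable_tnth _ _ n i)).
  + by move=> t; exact: bigmule_ge0.
Qed.

Lemma le_bigmule n (h : 'I_n -> \bar R) (c : R) : (0 <= c)%R ->
  (forall i, c%:E <= h i) -> (c ^+ n)%:E <= \big[mule/1]_(i < n) h i.
Proof.
move=> c0; elim: n h => [h _|n IH h hc]; first by rewrite big_ord0.
rewrite big_ord_recl exprS EFinM lee_pmul ?lee_fin ?exprn_ge0//.
by apply: IH => i.
Qed.

End Tint.

(** * Cubes and null sets *)

Section Cubes.
Context {R : realType}.

Definition cube n (a : 'I_n -> R) (l : R) : set (n.-tuple R) :=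
  [set t | forall i, a i <= tnth t i <= a i + l].

(** Unlike in [nullRn], the set itself is measurable, so that a cube minus it can be integrated. *)
Definition null n (B : set (n.-tuple R)) : Prop :=
  measurable B /\ tint (fun t => ((\1_B t : R))%:E) = 0%E.

Lemma null0 n : null n set0.
Proof.
split => //; rewrite -[RHS](@tint0 R n); apply: eq_tint => t.
by rewrite indicE in_set0.
Qed.

Lemma indic_cube n (a : 'I_n -> R) l t :
  (\1_(cube n a l) t : R)%:E =
  (\big[mule/1]_(i < n) (\1_(`[a i, (a i + l)%R]%classic) (tnth t i) : R)%:E)%E.
Proof.
rewrite -(big_morph EFin (@EFinM R) (erefl 1%:E)).
congr EFin; rewrite indicE; have [/set_mem tc|] := boolP (t \in _).
  rewrite big1// => i _; rewrite indicE mem_set//= in_itv/=; exact: tc.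
rewrite notin_setE/= => /existsNP[i ti].
rewrite (bigD1 i)//= indicE memNset ?mul0r//= in_itv/=.
Qed.

Lemma measurable_cube n (a : 'I_n -> R) l : measurable (cube n a l).
Proof.
rewrite (_ : cube n a l =
  \bigcap_(i in [set: 'I_n]) ((fun t => tnth t i) @^-1` `[a i, a i + l]%classic)).
  apply: fin_bigcap_measurable => // i _; rewrite -[X in measurable X]setTI.
  exact: measurable_tnth.
apply/seteqP; split=> t /=.
  by move=> tc i _; rewrite /= in_itv/=; exact: tc.
by move=> tc i; have := tc i I; rewrite /= in_itv.
Qed.

Lemma lebesgue_itvcc (a l : R) : 0 <= l ->
  (lebesgue_measure `[a, (a + l)%R]%classic = l%:E)%E.
Proof.
move=> l0; rewrite lebesgue_measure_itv/= lte_fin ltrDl.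
case: ltP => [_|]; first by rewrite -EFinD addrC addKr.
by move=> l1; have -> : l = 0 by apply/le_anti; rewrite l0 l1.
Qed.

Lemma integral_itvcc (a l : R) : 0 <= l ->
  (\int[@lebesgue_measure R]_s (\1_(`[a, (a + l)%R]%classic) s : R)%:E = l%:E)%E.
Proof. by move=> l0; rewrite integral_indic// setIT; exact: lebesgue_itvcc. Qed.

Lemma tint_cube n (a : 'I_n -> R) l : 0 <= l ->
  tint (fun t => ((\1_(cube n a l) t : R))%:E) = (l ^+ n)%:E.
Proof.
move=> l0; under eq_tint do rewrite indic_cube.
rewrite (tint_prod _ (fun i s => (\1_(`[a i, (a i + l)%R]%classic) s)%:E)).
- under eq_bigr do rewrite integral_itvcc//.
  rewrite -(big_morph EFin (@EFinM R) (erefl 1%:E)).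
  by rewrite prodr_const card_ord.
- move=> i; apply/measurable_EFinP; exact: measurable_indic.
- by move=> i x; rewrite lee_fin.
Qed.

Lemma measurable_EFin_indic d (T : measurableType d) (A : set T) : measurable A ->
  measurable_fun setT (fun t => (\1_A t : R)%:E).
Proof. by move=> mA; apply/measurable_EFinP; exact: measurable_indic. Qed.

(** The tool for all lower bounds: [B] will be the set off which the trace is controlled, and [f] is
    compared with [c] times the indicator of the cube minus [B]. *)
Lemma le_tint_cube n (a : 'I_n -> R) l B (f : n.-tuple R -> \bar R) c :
  0 <= l -> 0 <= c -> null n B -> (forall t, 0 <= f t)%E ->
  (forall t, cube n a l t -> ~ B t -> (c%:E <= f t)%E) ->
  ((c * l ^+ n)%:E <= tint f)%E.
Proof.
move=> l0 c0 [mB B0] f0 cf.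
have mC := measurable_cube n a l.
have mCB : measurable (cube n a l `\` B) by exact: measurableD.
have h : ((l ^+ n)%:E <= tint (fun t => (\1_(cube n a l `\` B) t : R)%:E))%E.
  (* Zero is added as the integral of the indicator of [B], because the indicator of the cube is at
     most that of the difference plus that of [B]. *)
  rewrite -(tint_cube _ a)// -[leRHS]adde0 -B0 -tintD; last 4 first.
  - exact: measurable_EFin_indic.
  - by move=> t; rewrite lee_fin.
  - exact: measurable_EFin_indic.
  - by move=> t; rewrite lee_fin.
  apply: le_tint => t; first by rewrite lee_fin.
  rewrite -EFinD lee_fin !indicE in_setD.
  by case: (_ \in cube _ _ _); case: (_ \in B); rewrite //= ?addr0 ?add0r ?ler01 ?addr_ge0.
rewrite EFinM; apply: (@le_trans _ _ (c%:E *
    tint (fun t => (\1_(cube n a l `\` B) t : R)%:E))%E).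
  by apply: lee_pmul; rewrite ?lee_fin ?exprn_ge0.
rewrite -tintZl; last 3 first.
- exact: measurable_EFin_indic.
- by move=> t; rewrite lee_fin.
- by rewrite lee_fin.
apply: le_tint => t; first by rewrite -EFinM lee_fin mulr_ge0.
rewrite indicE; have [/set_mem [tC tB]|_] := boolP (t \in _).
  by rewrite mule1; exact: cf.
by rewrite mule0.
Qed.

(** If the cube were inside [B], the preceding bound would apply vacuously to f = 0 and c = 1,
    against l^n > 0. *)
Lemma null_cube n (a : 'I_n -> R) l B : 0 < l -> null n B ->
  exists t, cube n a l t /\ ~ B t.
Proof.
move=> l0 nB; apply: contrapT => /forallNP h.
have : ((1 * l ^+ n)%:E <= tint (fun _ : n.-tuple R => 0))%E.
  apply: (le_tint_cube n a l B) => // [|t tc Bt]; first exact: ltW.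
  by have := h t; move=> /not_andP[].
by rewrite tint0 lee_fin mul1r leNgt exprn_gt0.
Qed.

(** Produces a point of an arbitrarily small box at which an almost everywhere statement holds; this
    is how such statements are carried to the boundary. *)
Lemma nullRN_cube N (a : 'I_(N.-1) -> R) (b l : R) (A : set (pt R N)) : 0 < l ->
  nullRN A ->
  exists x : pt R N, [/\ cube _ a l x.1, b <= x.2 <= b + l & ~ A x].
Proof.
move=> l0 [B [mB [AB B0]]]; apply: contrapT => /forallNP h.
suff : ((l * l ^+ N.-1)%:E <= intRN (fun x : pt R N => ((\1_B x : R))%:E))%E.
  by rewrite B0 lee_fin leNgt mulr_gt0// exprn_gt0.
apply: (le_tint_cube _ a l set0) => //; rewrite ?ltW//.
- exact: null0.
- by move=> t; apply: integral_ge0 => s _; rewrite lee_fin.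
- move=> t tc _; rewrite -(integral_itvcc b l (ltW l0)).
  apply: ge0_integral_mono => s _; rewrite lee_fin//.
  rewrite !indicE; have [/set_mem|//] := boolP (s \in _); rewrite /= in_itv/= => bs.
  rewrite mem_set//; apply: AB; apply: contrapT => nA.
  by apply: (h (t, s)).
Qed.

End Cubes.

(** * Euclidean distances *)

Section Distances.
Context {R : realType}.

(** Indexed by any finite type so that one Minkowski inequality serves both [tdist], indexed by the
    coordinates, and [pdist], indexed by a [bool] that separates horizontal distance and height. *)
Definition l2norm (I : finType) (f : I -> R) : R := Num.sqrt (\sum_i f i ^+ 2).

Lemma l2norm_ge0 (I : finType) (f : I -> R) : 0 <= l2norm I f.
Proof. exact: sqrtr_ge0. Qed.

Lemma sqr_l2norm (I : finType) (f : I -> R) : l2norm I f ^+ 2 = \sum_i f i ^+ 2.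
Proof. by rewrite sqr_sqrtr// sumr_ge0// => i _; exact: sqr_ge0. Qed.

Lemma le_l2norm (I : finType) (f : I -> R) i : `|f i| <= l2norm I f.
Proof.
rewrite -ler_sqr ?nnegrE ?l2norm_ge0// sqr_l2norm real_normK ?num_real//.
by rewrite (bigD1 i)//= lerDl sumr_ge0// => j _; exact: sqr_ge0.
Qed.

Lemma cauchy_schwarz (I : finType) (f g : I -> R) :
  \sum_i f i * g i <= l2norm I f * l2norm I g.
Proof.
set u := l2norm I f; set v := l2norm I g.
have u0 : 0 <= u by exact: l2norm_ge0.
have v0 : 0 <= v by exact: l2norm_ge0.
have [uv|uv] := eqVneq (u * v) 0.
  rewrite uv big1// => i _.
  have fi := le_l2norm I f i; have gi := le_l2norm I g i.
  move/eqP: uv; rewrite mulf_eq0 => /orP[] /eqP z.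
    by move: fi; rewrite -/u z normr_le0 => /eqP ->; rewrite mul0r.
  by move: gi; rewrite -/v z normr_le0 => /eqP ->; rewrite mulr0.
have uv0 : 0 < u * v by rewrite lt_neqAle eq_sym uv mulr_ge0.
(* Expanded, this reads 2 (u v)^2 - 2 u v S >= 0 with S the scalar product; it remains to divide by
   u v. *)
have : 0 <= \sum_i (v * f i - u * g i) ^+ 2 by apply: sumr_ge0 => i _; exact: sqr_ge0.
have -> : \sum_i (v * f i - u * g i) ^+ 2 =
    v ^+ 2 * \sum_i f i ^+ 2 + u ^+ 2 * \sum_i g i ^+ 2
    - 2 * (u * v) * \sum_i f i * g i.
  rewrite !mulr_sumr -sumrN -!big_split/=; apply: eq_bigr => i _; ring.
rewrite -!sqr_l2norm -/u -/v => h.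
rewrite -(ler_pM2l uv0); nra.
Qed.

Lemma minkowski (I : finType) (f g : I -> R) :
  l2norm I (fun i => f i + g i) <= l2norm I f + l2norm I g.
Proof.
have := cauchy_schwarz I f g.
have := l2norm_ge0 I f; have := l2norm_ge0 I g => v0 u0 cs.
rewrite -ler_sqr ?nnegrE ?l2norm_ge0 ?addr_ge0// sqr_l2norm sqrrD !sqr_l2norm.
have -> : \sum_i (f i + g i) ^+ 2 =
    \sum_i f i ^+ 2 + \sum_i g i ^+ 2 + 2 * \sum_i f i * g i.
  rewrite !mulr_sumr -!big_split/=; apply: eq_bigr => i _; ring.
move: cs; set A := \sum_i f i * g i; set B := _ * _; lra.
Qed.

Lemma tdistE n (a b : n.-tuple R) : tdist a b = l2norm 'I_n (fun i => tnth a i - tnth b i).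
Proof. by []. Qed.

Lemma tdist_ge0 n (a b : n.-tuple R) : 0 <= tdist a b.
Proof. exact: sqrtr_ge0. Qed.

Lemma tdistC n (a b : n.-tuple R) : tdist a b = tdist b a.
Proof.
by congr Num.sqrt; apply: eq_bigr => i _; rewrite -sqrrN opprB.
Qed.

Lemma tdist_triangle n (a b c : n.-tuple R) : tdist a c <= tdist a b + tdist b c.
Proof.
rewrite !tdistE; apply: le_trans (minkowski _ _ _).
by rewrite le_eqVlt; apply/orP; left; apply/eqP; congr Num.sqrt;
  apply: eq_bigr => i _; congr (_ ^+ _); ring.
Qed.

Lemma le_tdist n (a b : n.-tuple R) i : `|tnth a i - tnth b i| <= tdist a b.
Proof. exact: (le_l2norm _ (fun i => tnth a i - tnth b i)). Qed.

Lemma tdist_xx n (a : n.-tuple R) : tdist a a = 0.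
Proof.
by rewrite /tdist /sqdist big1 ?sqrtr0// => i _; rewrite subrr expr0n.
Qed.

Lemma tdist_gt0 n (a b : n.-tuple R) : a != b -> 0 < tdist a b.
Proof.
move=> ab; rewrite lt_neqAle tdist_ge0 andbT eq_sym; apply: contra ab => /eqP z.
apply/eqP/eq_from_tnth => i; have := le_tdist _ a b i.
by rewrite z normr_le0 subr_eq0 => /eqP.
Qed.

Lemma tdist_le n (a b : n.-tuple R) l : 0 <= l ->
  (forall i, `|tnth a i - tnth b i| <= l) -> tdist a b <= n%:R * l.
Proof.
move=> l0 h; rewrite -ler_sqr ?nnegrE ?tdist_ge0 ?mulr_ge0// tdistE sqr_l2norm.
apply: (@le_trans _ _ (\sum_(i < n) l ^+ 2)).
  apply: ler_sum => i _; rewrite -(@real_normK _ (_ - _)) ?num_real//.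
  by rewrite ler_sqr ?nnegrE.
rewrite sumr_const card_ord -[leLHS]mulr_natl exprMn.
apply: ler_wpM2r; first exact: sqr_ge0.
by rewrite -natrX ler_nat; case: n {a b h} => // n; rewrite expnS leq_pmulr// expn_gt0.
Qed.

Definition origin n : n.-tuple R := [tuple of nseq n 0].
Definition tnorm n (a : n.-tuple R) : R := tdist a (origin n).

Lemma tnth_origin n i : tnth (origin n) i = 0.
Proof. by rewrite tnth_nseq. Qed.

Lemma tnorm_ge0 n (a : n.-tuple R) : 0 <= tnorm n a.
Proof. exact: tdist_ge0. Qed.

Variable N : nat.
Implicit Types x y z : pt R N.

Lemma pdistE x y : pdist x y =
  l2norm bool (fun b => if b then tdist x.1 y.1 else x.2 - y.2).
Proof.
congr Num.sqrt; rewrite big_bool/= tdistE; congr +%R; rewrite sqr_l2norm.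
by apply: eq_bigr.
Qed.

Lemma le_l2norm_bool (a b c e : R) : 0 <= a <= c -> `|b| <= `|e| ->
  l2norm bool (fun t => if t then a else b) <=
  l2norm bool (fun t => if t then c else e).
Proof.
move=> /andP[a0 ac] be; apply: ler_wsqrtr; rewrite !big_bool/=.
rewrite -(real_normK (num_real b)) -(real_normK (num_real e)).
apply: lerD; rewrite ler_sqr ?nnegrE//; exact: le_trans ac.
Qed.

Lemma pdist_ge0 x y : 0 <= pdist x y.
Proof. exact: sqrtr_ge0. Qed.

Lemma pdistC x y : pdist x y = pdist y x.
Proof.
congr Num.sqrt; congr +%R; last by rewrite -sqrrN opprB.
by apply: eq_bigr => i _; rewrite -sqrrN opprB.
Qed.

Lemma pdist_triangle x y z : pdist x z <= pdist x y + pdist y z.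
Proof.
rewrite !pdistE; apply: le_trans (minkowski _ _ _).
have -> : (fun i : bool => (if i then tdist x.1 y.1 else x.2 - y.2) +
    (if i then tdist y.1 z.1 else y.2 - z.2)) =
  (fun t : bool => if t then tdist x.1 y.1 + tdist y.1 z.1 else x.2 - z.2).
  by apply/funext => -[]//; ring.
by apply: le_l2norm_bool; rewrite ?tdist_ge0 ?tdist_triangle.
Qed.

Lemma le_tdist_pdist x y : tdist x.1 y.1 <= pdist x y.
Proof.
rewrite pdistE; apply: le_trans (le_l2norm _ _ true).
by rewrite ger0_norm ?tdist_ge0.
Qed.

Lemma le_dist2_pdist x y : `|x.2 - y.2| <= pdist x y.
Proof. by rewrite pdistE; apply: le_trans (le_l2norm _ _ false). Qed.

Lemma pdist_le x y : pdist x y <= tdist x.1 y.1 + `|x.2 - y.2|.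
Proof.
have t0 := tdist_ge0 _ x.1 y.1; have n0 := normr_ge0 (x.2 - y.2).
rewrite -ler_sqr ?nnegrE ?pdist_ge0 ?addr_ge0// pdistE sqr_l2norm big_bool/=.
rewrite -(real_normK (num_real (x.2 - y.2))); nra.
Qed.

Lemma pdist_gt0 x y : x != y -> 0 < pdist x y.
Proof.
move=> xy; rewrite lt_neqAle pdist_ge0 andbT eq_sym; apply: contra xy => /eqP z.
have := le_tdist_pdist x y; have := le_dist2_pdist x y; rewrite z normr_le0 subr_eq0.
move=> /eqP e2 t0; rewrite [x]surjective_pairing [y]surjective_pairing e2.
have [->//|/tdist_gt0] := eqVneq x.1 y.1; by rewrite ltNge t0.
Qed.

Lemma pdist_boundary (a b : (N.-1).-tuple R) : pdist (a, 0) (b, 0) = tdist a b.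
Proof. by rewrite /pdist/= subrr expr0n addr0. Qed.

Lemma pnormE x : pnorm x = pdist x (origin _, 0).
Proof.
congr Num.sqrt; rewrite /= subr0; congr +%R.
by apply: eq_bigr => i _; rewrite tnth_origin subr0.
Qed.

Lemma pnorm_ge0 x : 0 <= pnorm x.
Proof. exact: sqrtr_ge0. Qed.

Lemma pnorm_boundary a : pnorm ((a, 0) : pt R N) = tnorm _ a.
Proof. by rewrite pnormE pdist_boundary. Qed.

Lemma pdist_reflect x y : pdist (reflect_pt x) (reflect_pt y) = pdist x y.
Proof. by congr (Num.sqrt (_ + _)); rewrite /=; ring. Qed.

Lemma measurable_sqrtr : measurable_fun [set: R] (@Num.sqrt R).
Proof. by apply: continuous_measurable_fun; exact: sqrt_continuous. Qed.

Lemma measurable_tdist d (T : measurableType d) n (f g : T -> n.-tuple R) :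
  measurable_fun setT f -> measurable_fun setT g ->
  measurable_fun setT (fun t => tdist (f t) (g t)).
Proof.
move=> mf mg; apply: (measurableT_comp measurable_sqrtr).
apply: measurable_sum => i; apply: measurable_funX; apply: measurable_funB.
  exact: (measurableT_comp (@measurable_tnth _ _ n i) mf).
exact: (measurableT_comp (@measurable_tnth _ _ n i) mg).
Qed.

Lemma measurable_pdist d (T : measurableType d) (f g : T -> pt R N) :
  measurable_fun setT f -> measurable_fun setT g ->
  measurable_fun setT (fun t => pdist (f t) (g t)).
Proof.
move=> mf mg; apply: (measurableT_comp measurable_sqrtr).
apply: measurable_funD; last first.
  apply: measurable_funX; apply: measurable_funB.
    exact: (measurableT_comp measurable_snd mf).
  exact: (measurableT_comp measurable_snd mg).
apply: measurable_sum => i; apply: measurable_funX; apply: measurable_funB.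
  exact: (measurableT_comp (@measurable_tnth _ _ _ i) (measurableT_comp measurable_fst mf)).
exact: (measurableT_comp (@measurable_tnth _ _ _ i) (measurableT_comp measurable_fst mg)).
Qed.

End Distances.

(** * Decay of convolutions with Riesz kernels *)

Section KernelDecay.
Context {R : realType}.
Implicit Types a b m q s t u v : R.

Lemma le_powRN u v a : 0 < u -> u <= v -> 0 <= a -> v `^ (- a) <= u `^ (- a).
Proof.
move=> u0 uv a0; have v0 : 0 < v by exact: lt_le_trans uv.
rewrite !powRN lef_pV2 ?posrE ?powR_gt0//.
by apply: ge0_ler_powR; rewrite ?nnegrE// ltW.
Qed.

Lemma geometric_le q n : 0 <= q < 1 -> \sum_(i < n) q ^+ i <= (1 - q)^-1.
Proof.
move=> /andP[q0 q1]; rewrite -[leRHS]mul1r ler_pdivlMr ?subr_gt0//.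
rewrite mulrC -opprB mulNr -subrX1 opprB lerBlDr lerDl exprn_ge0//.
Qed.

Definition step (c r s : R) : R := c * (`|s| <= r)%R%:R.

Lemma step_ge0 (c r s : R) : 0 <= c -> 0 <= step c r s.
Proof. by move=> c0; rewrite mulr_ge0. Qed.

(** Countable sums of centred steps: with dyadic radii they dominate powers of |s|, and their
    integrals are geometric series. *)
Definition stepsum (c r : nat -> R) (s : R) : \bar R :=
  (\sum_(j <oo) (step (c j) (r j) s)%:E)%E.

Lemma stepsum_ge (c r : nat -> R) s j : (forall i, 0 <= c i) -> `|s| <= r j ->
  ((c j)%:E <= stepsum c r s)%E.
Proof.
move=> c0 sj; rewrite /stepsum (nneseries_split 0 j.+1)//; last first.
  by move=> i _; rewrite lee_fin step_ge0.
rewrite big_nat_recr//= /step sj mulr1 -[leLHS]add0e -addeA leeD//.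
  by apply: sume_ge0 => i _; rewrite lee_fin step_ge0.
by rewrite leeDl// nneseries_ge0// => i _ _; rewrite lee_fin step_ge0.
Qed.

Lemma stepsum_ge0 (c r : nat -> R) s : (forall i, 0 <= c i) -> (0 <= stepsum c r s)%E.
Proof. by move=> c0; apply: nneseries_ge0 => i _ _; rewrite lee_fin step_ge0. Qed.

Lemma step_indic x s q :
  (`|x - s| <= q)%R%:R = \1_(`[x - q, (x - q + (q + q))%R]%classic) s :> R.
Proof.
rewrite indicE; congr (nat_of_bool _)%:R; apply/idP/idP => [|].
  rewrite ler_norml => /andP[h1 h2]; apply: mem_set; rewrite /= in_itv/=.
  by apply/andP; split; lra.
by move=> /set_mem; rewrite /= in_itv/= => /andP[h1 h2]; rewrite ler_norml; lra.
Qed.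

Lemma measurable_step x c q :
  measurable_fun setT (fun s => (step c q (x - s))%:E).
Proof.
rewrite /step; under eq_fun do rewrite step_indic.
apply/measurable_EFinP; apply: measurable_funM; first exact: measurable_cst.
exact: measurable_indic.
Qed.

Lemma measurable_stepsum (c r : nat -> R) x : (forall i, 0 <= c i) ->
  measurable_fun setT (fun s => stepsum c r (x - s)).
Proof.
move=> c0; apply: ge0_emeasurable_sum => [j s _ _|j _].
  by rewrite lee_fin step_ge0.
exact: measurable_step.
Qed.

(** A step of height c_i and radius r_i has integral 2 c_i r_i, at most 2 M q^i. *)
Lemma integral_stepsum (c r : nat -> R) q M x : 0 <= q < 1 -> 0 <= M ->
  (forall i, 0 <= c i) -> (forall i, 0 <= r i) ->
  (forall i, c i * r i <= M * q ^+ i) ->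
  (\int[@lebesgue_measure R]_s stepsum c r (x - s) <= (2 * M / (1 - q))%:E)%E.
Proof.
move=> q01 M0 c0 r0 cr.
rewrite integral_nneseries//; last 2 first.
- by move=> j; exact: measurable_step.
- by move=> j s _; rewrite lee_fin step_ge0.
apply: lime_le.
  apply: is_cvg_nneseries => i _ _; apply: integral_ge0 => s _.
  by rewrite lee_fin step_ge0.
apply: nearW => n; rewrite big_mkord.
apply: (@le_trans _ _ (\sum_(i < n) (2 * M * q ^+ i)%:E)%E).
  apply: lee_sum => i _.
  under eq_integral do rewrite /step EFinM step_indic.
  rewrite ge0_integralZl_EFin//; last first.
    exact: measurable_EFin_indic.
  rewrite integral_itvcc ?addr_ge0// -EFinM lee_fin.
  by have := cr i; lra.
rewrite sumEFin lee_fin -mulr_sumr ler_wpM2l ?mulr_ge0// geometric_le//.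
Qed.

End KernelDecay.

Section RadialMajorant.
Context {R : realType}.

Lemma powR_exprn (u a : R) n : 0 <= u -> (u ^+ n) `^ a = (u `^ a) ^+ n.
Proof. by move=> u0; rewrite -(powR_mulrn n u0) -(powR_mulrn n (powR_ge0 u a)) powRAC. Qed.

Lemma pow2_lt1 (t : R) : t < 0 -> 2 `^ t < 1 :> R.
Proof.
move=> t0; rewrite /powR gt_eqF// expR_lt1 nmulr_rlt0// ln_gt0//; lra.
Qed.

Lemma dyadic_floor (r : R) : 1 <= r -> exists j, 2 ^+ j <= r < 2 ^+ j.+1.
Proof.
move=> r1.
have ex : exists j, r < 2 ^+ j.+1.
  exists (Num.truncn r).+1; apply: lt_trans (truncnS_gt r) _.
  by rewrite -natrX ltr_nat (leq_trans (ltn_expl _ (ltnSn 1)))// leq_exp2l.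
case: (ex_minnP ex) => -[|j] rj minj; first by exists 0%N; rewrite expr0 r1.
exists j.+1; rewrite rj andbT leNgt; apply/negP => /minj.
by rewrite ltnn.
Qed.

(** Dyadic substitute for |s|^(-a) near 0, by the first sum, plus |s|^(-b) at infinity, by the
    second. *)
Definition majorant (a b s : R) : \bar R :=
  (stepsum (fun j => ((2 ^+ j.+1) `^ a)%R) (fun j => (2 ^+ j)^-1%R) s +
   stepsum (fun j => ((2 ^+ j) `^ (- b))%R) (fun j => (2 ^+ j.+1)%R) s)%E.

Lemma majorant_ge0 a b s : (0 <= majorant a b s)%E.
Proof. by apply: adde_ge0; apply: stepsum_ge0 => i; exact: powR_ge0. Qed.

Lemma measurable_majorant a b (x : R) :
  measurable_fun setT (fun s : R => majorant a b (x - s)).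
Proof.
by apply: emeasurable_funD; apply: measurable_stepsum => i; exact: powR_ge0.
Qed.

(** The power is that of an upper bound [r] of |s|, since [s] will be one coordinate of x - y and
    [r] a bound for the whole distance. *)
Lemma majorant_near a b s r : 0 <= a -> `|s| <= r -> 0 < r <= 1 ->
  ((r `^ (- a))%:E <= majorant a b s)%E.
Proof.
move=> a0 sr /andP[r0 r1].
have [|j /andP[j1 j2]] := dyadic_floor r^-1; first by rewrite invf_ge1.
apply: le_trans (leeDl _ _); last by apply: stepsum_ge0 => i; exact: powR_ge0.
apply: le_trans (stepsum_ge _ _ _ j _ _).
- rewrite lee_fin powRN -powR_inv1; last exact: powR_ge0.
  rewrite powRAC powR_inv1; last exact: ltW.
  by apply: ge0_ler_powR; rewrite ?nnegrE ?exprn_ge0 ?invr_ge0// ltW.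
- by move=> i; exact: powR_ge0.
- apply: le_trans sr _; rewrite -[r]invrK lef_pV2 ?posrE ?exprn_gt0 ?invr_gt0//.
Qed.

Lemma majorant_far a b s r : 0 <= b -> `|s| <= r -> 1 <= r ->
  ((r `^ (- b))%:E <= majorant a b s)%E.
Proof.
move=> b0 sr r1.
have [j /andP[j1 j2]] := dyadic_floor r r1.
apply: le_trans (leeDr _ _); last by apply: stepsum_ge0 => i; exact: powR_ge0.
apply: le_trans (stepsum_ge _ _ _ j _ _).
- by rewrite lee_fin le_powRN// exprn_gt0.
- by move=> i; exact: powR_ge0.
- by apply: le_trans sr _; exact: ltW.
Qed.

Lemma integral_majorant a b : a < 1 -> 1 < b -> exists2 M : R, 0 < M &
  forall x, (\int[@lebesgue_measure R]_s majorant a b (x - s) <= M%:E)%E.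
Proof.
move=> a1 b1.
have q1 : 0 <= 2 `^ (a - 1) < 1 by rewrite powR_ge0 pow2_lt1// subr_lt0.
have q2 : 0 <= 2 `^ (1 - b) < 1 by rewrite powR_ge0 pow2_lt1// subr_lt0.
(* Height times radius at level j equals 2^a (2^(a-1))^j in the first sum and 2 (2^(1-b))^j in the
   second. *)
exists (2 * 2 `^ a / (1 - 2 `^ (a - 1)) + 2 * 2 / (1 - 2 `^ (1 - b))).
  by rewrite addr_gt0// divr_gt0// ?mulr_gt0 ?powR_gt0// subr_gt0;
    [case/andP: q1|case/andP: q2].
move=> x; rewrite ge0_integralD//; last 4 first.
- by move=> s _; apply: stepsum_ge0 => i; exact: powR_ge0.
- by apply: measurable_stepsum => i; exact: powR_ge0.
- by move=> s _; apply: stepsum_ge0 => i; exact: powR_ge0.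
- by apply: measurable_stepsum => i; exact: powR_ge0.
rewrite EFinD; apply: leeD; apply: integral_stepsum => //.
- move=> i; rewrite exprS powRM ?exprn_ge0// powR_exprn// -mulrA.
  rewrite powRD ?pnatr_eq0 ?implybT// powR_inv1// exprMn exprVn.
  by rewrite le_eqVlt eqxx.
- move=> i; rewrite powRD ?pnatr_eq0 ?implybT// powRr1// exprMn powR_exprn//.
  by rewrite exprS le_eqVlt; apply/orP; left; apply/eqP; ring.
Qed.

End RadialMajorant.

Lemma bigmule_le (R : realType) n (h : 'I_n -> \bar R) (c : R) : 0 <= c ->
  (forall i, 0 <= h i <= c%:E)%E -> (\big[mule/1]_(i < n) h i <= (c ^+ n)%:E)%E.
Proof.
move=> c0; elim: n h => [h _|n IH h hc]; first by rewrite big_ord0.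
rewrite big_ord_recl exprS EFinM; have /andP[h0 h0c] := hc ord0.
apply: lee_pmul => //; last by apply: IH => i; exact: hc.
by apply: bigmule_ge0 => i; case/andP: (hc (lift ord0 i)).
Qed.

Lemma powRD_gt0 (R : realType) (x r s : R) : 0 < x -> x `^ (r + s) = x `^ r * x `^ s.
Proof. by move=> x0; rewrite powRD// (gt_eqF x0) implybT. Qed.

Section KernelIntegral.
Context {R : realType} (N : nat).
Local Notation n := (N.-1).
Hypothesis n0 : (0 < n)%N.

(** The exponents a/n and b/n make the n factors together dominate |x - y|^(-a) near the diagonal
    and |x - y|^(-b) far from it, while the integral factorises. *)
Definition pmaj (a b : R) (x y : n.-tuple R) : \bar R :=
  (\big[mule/1]_(i < n) majorant (a / n%:R) (b / n%:R) (tnth x i - tnth y i))%E.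

Lemma pmaj_ge0 a b x y : (0 <= pmaj a b x y)%E.
Proof. by apply: bigmule_ge0 => i; exact: majorant_ge0. Qed.

Lemma measurable_pmaj a b x : measurable_fun setT (pmaj a b x).
Proof.
have := measurable_bigmule _ _ _ (fun i (y : n.-tuple R) =>
  majorant (a / n%:R) (b / n%:R) (tnth x i - tnth y i)); apply => i.
exact: (measurableT_comp (measurable_majorant (a / n%:R) (b / n%:R) (tnth x i))
  (@measurable_tnth _ _ n i)).
Qed.

Lemma powR_exprn_div (r a : R) : 0 < r -> (r `^ (- (a / n%:R))) ^+ n = r `^ (- a).
Proof.
move=> r0; rewrite -powR_mulrn ?powR_ge0// -powRrM; congr (_ `^ _).
by rewrite mulNr divfK// pnatr_eq0 -lt0n.
Qed.

Lemma pmaj_near a b x y r : 0 <= a -> tdist x y <= r -> 0 < r <= 1 ->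
  ((r `^ (- a))%:E <= pmaj a b x y)%E.
Proof.
move=> a0 xy r01; rewrite -powR_exprn_div; last by case/andP: r01.
apply: le_bigmule => [|i]; first exact: powR_ge0.
apply: majorant_near => //; first by rewrite divr_ge0.
exact: le_trans (le_tdist _ _ _ _) xy.
Qed.

Lemma pmaj_far a b x y r : 0 <= b -> tdist x y <= r -> 1 <= r ->
  ((r `^ (- b))%:E <= pmaj a b x y)%E.
Proof.
move=> b0 xy r1; rewrite -powR_exprn_div; last exact: lt_le_trans r1.
apply: le_bigmule => [|i]; first exact: powR_ge0.
apply: majorant_far => //; first by rewrite divr_ge0.
exact: le_trans (le_tdist _ _ _ _) xy.
Qed.

(** A finite value v is impossible: the near bound at radius (v + 1)^(-1/a) would give v + 1 <= v.
    The majorant must be infinite here because [kerk] is. *)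
Lemma pmaj_diag a b x : 0 < a -> pmaj a b x x = +oo%E.
Proof.
move=> a0; case/gee0P: (pmaj_ge0 a b x x) => // -[r r0 xr].
have r1 : 0 < r + 1 by lra.
have : ((((r + 1) `^ (- a^-1)) `^ (- a))%:E <= pmaj a b x x)%E.
  apply: pmaj_near; [exact: ltW|by rewrite tdist_xx powR_ge0|].
  have e : 1 `^ (- a^-1) = 1 :> R by rewrite powR1.
  rewrite powR_gt0//= -[leRHS]e le_powRN//; first lra.
  by rewrite invr_ge0 ltW.
rewrite xr lee_fin -powRrM mulrNN mulVf ?gt_eqF// powRr1; last exact: ltW.
by clear xr => h; exfalso; lra.
Qed.

Lemma tint_pmaj a b : a < n%:R -> n%:R < b -> exists2 M : R, 0 < M &
  forall x, (tint (pmaj a b x) <= M%:E)%E.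
Proof.
move=> an nb; have nr : 0 < n%:R :> R by rewrite ltr0n.
have [||M M0 HM] := integral_majorant (a / n%:R) (b / n%:R).
- by rewrite ltr_pdivrMr// mul1r.
- by rewrite ltr_pdivlMr// mul1r.
exists (M ^+ n); first exact: exprn_gt0.
move=> x; rewrite (tint_prod _ (fun i s => majorant (a / n%:R) (b / n%:R) (tnth x i - s))).
- apply: bigmule_le => [|i]; first exact: ltW.
  by rewrite HM andbT; apply: integral_ge0 => s _; exact: majorant_ge0.
- by move=> i; exact: measurable_majorant.
- by move=> i s; exact: majorant_ge0.
Qed.

(** By the triangle inequality the larger of D = |x - y| and Y = 1 + |y| is at least half of X = 1 +
    |x|, so X^(-m) can be extracted from it. What remains has total exponent a + b - m at infinity
    and is centred at [x] if D <= Y, at the origin otherwise. *)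
Lemma kerk_bound (a b m : R) : 0 < a -> 0 <= m -> m <= a -> m <= b ->
  forall x y, (((1 + tnorm _ y) `^ (- b))%:E * @kerk R N a x y <=
    (2 `^ m * (1 + tnorm _ x) `^ (- m))%:E *
    (pmaj a (a + b - m) x y + pmaj a (a + b - m) (origin n) y))%E.
Proof.
move=> a0 m0 ma mb x y; set X := 1 + tnorm n x; set Y := 1 + tnorm n y.
have X1 : 1 <= X by rewrite lerDl tnorm_ge0.
have Y1 : 1 <= Y by rewrite lerDl tnorm_ge0.
have X0 : 0 < X by exact: lt_le_trans X1.
have Y0 : 0 < Y by exact: lt_le_trans Y1.
have c0 : 0 < 2 `^ m * X `^ (- m) by rewrite mulr_gt0// powR_gt0.
have c1 : (0 <= (2 `^ m * X `^ (- m))%:E)%E by rewrite lee_fin; exact: ltW.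
rewrite /kerk; have [<-|xy] := eqVneq x y.
  rewrite pmaj_diag// addye; last by rewrite gt_eqF// (lt_le_trans _ (pmaj_ge0 _ _ _ _)).
  rewrite gt0_muley; last by rewrite lte_fin; exact: powR_gt0.
  by rewrite gt0_muley; last by rewrite lte_fin; exact: c0.
have D0 := tdist_gt0 _ _ _ xy; set D := tdist x y in D0 *.
have e0 : 0 <= b - m by rewrite subr_ge0.
have key v : 0 < v -> X <= 2 * v -> v `^ (- m) <= 2 `^ m * X `^ (- m).
  move=> v0 Xv; apply: (@le_trans _ _ (2 `^ m * (2 * v) `^ (- m))).
    have p2 : 2 `^ m != 0 :> R by rewrite gt_eqF// powR_gt0.
    by rewrite powRM ?(ltW v0)// mulrA (powRN 2) divff// mul1r.
  apply: ler_wpM2l; first exact: powR_ge0.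
  exact: le_powRN.
have XYD : X <= Y + D.
  rewrite /X /Y /D; have := tdist_triangle _ x y (origin n).
  by rewrite /tnorm; lra.
rewrite -powRN -EFinM.
have [DY|YD] := leP D Y.
- apply: (@le_trans _ _ ((2 `^ m * X `^ (- m))%:E * pmaj a (a + b - m) x y)%E); last first.
    by apply: lee_wpmul2l => //; rewrite leeDl// pmaj_ge0.
  have YX : Y `^ (- m) <= 2 `^ m * X `^ (- m) by apply: key => //; lra.
  have -> : - b = - m + - (b - m) by ring.
  rewrite (powRD_gt0 _ Y _ _ Y0).
  (* The spare factor Y^(-(b - m)) is bounded by 1 when D <= 1; otherwise it is bounded by D^(-(b -
     m)), which joins D^(-a). *)
  have [D1|D1] := leP D 1.
    apply: (@le_trans _ _ ((2 `^ m * X `^ (- m))%:E * (D `^ (- a))%:E)%E).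
      rewrite -EFinM lee_fin; apply: ler_wpM2r; first exact: powR_ge0.
      rewrite -[leRHS]mulr1; apply: ler_pM => //; try exact: powR_ge0.
      by have := le_powRN 1 Y (b - m) ltr01 Y1 e0; rewrite powR1.
    apply: lee_wpmul2l => //; apply: pmaj_near => //; first exact: ltW.
    by rewrite D0.
  apply: (@le_trans _ _ ((2 `^ m * X `^ (- m))%:E * (D `^ (- (a + b - m)))%:E)%E).
    rewrite -EFinM lee_fin -[leLHS]mulrA.
    apply: ler_pM => //; [exact: powR_ge0|by apply: mulr_ge0; exact: powR_ge0|].
    have -> : - (a + b - m) = - (b - m) + - a by ring.
    rewrite (powRD_gt0 _ D _ _ D0); apply: ler_wpM2r; first exact: powR_ge0.
    exact: le_powRN.
  apply: lee_wpmul2l => //; apply: pmaj_far => //; [lra|exact: ltW].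
- apply: (@le_trans _ _ ((2 `^ m * X `^ (- m))%:E * pmaj a (a + b - m) (origin n) y)%E); last first.
    by apply: lee_wpmul2l => //; rewrite leeDr// pmaj_ge0.
  have DX : D `^ (- m) <= 2 `^ m * X `^ (- m) by apply: key => //; lra.
  apply: (@le_trans _ _ ((2 `^ m * X `^ (- m))%:E * (Y `^ (- (a + b - m)))%:E)%E); last first.
    apply: lee_wpmul2l => //; apply: pmaj_far => //; first lra.
    by rewrite tdistC lerDr.
  (* Since Y < D, the remaining D^(-(a - m)) is at most Y^(-(a - m)), which joins Y^(-b). *)
  have -> : - a = - m + - (a - m) by ring.
  rewrite (powRD_gt0 _ D _ _ D0) -!EFinM lee_fin mulrCA.
  apply: ler_pM => //; [exact: powR_ge0|by apply: mulr_ge0; exact: powR_ge0|].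
  have -> : - (a + b - m) = - b + - (a - m) by ring.
  rewrite (powRD_gt0 _ Y _ _ Y0); apply: ler_wpM2l; first exact: powR_ge0.
  by apply: le_powRN => //; [exact: ltW|rewrite subr_ge0].
Qed.

(** Here a < n is integrability at the diagonal, and n < a + b - m integrability at infinity once
    decay of order m has been spent on [x]. It serves three times: for H_v, for its single layer
    potential and for the Hölder estimate. *)
Lemma tint_kernel_decay (a b m : R) : 0 < a -> a < n%:R -> 0 <= m -> m <= a -> m <= b ->
  n%:R < a + b - m -> exists2 C : R, 0 < C & forall x,
  (tint (fun y => ((1 + tnorm _ y) `^ (- b))%:E * @kerk R N a x y) <=
    (C * (1 + tnorm _ x) `^ (- m))%:E)%E.
Proof.
move=> a0 an m0 ma mb nab.
have [M M0 HM] := tint_pmaj a (a + b - m) an nab.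
exists (2 `^ m * (M + M)); first by rewrite mulr_gt0 ?powR_gt0// addr_gt0.
move=> x; apply: le_trans (le_tint _ _ _ _ (kerk_bound a b m a0 m0 ma mb x)) _.
  move=> y; rewrite mule_ge0// ?lee_fin ?powR_ge0// /kerk.
  by case: ifP => // _; rewrite lee_fin invr_ge0 powR_ge0.
rewrite tintZl; first last.
- by rewrite lee_fin; apply: mulr_ge0; exact: powR_ge0.
- by move=> y; rewrite adde_ge0// pmaj_ge0.
- by apply: emeasurable_funD; exact: measurable_pmaj.
rewrite tintD; last 4 first.
- exact: measurable_pmaj.
- exact: pmaj_ge0.
- exact: measurable_pmaj.
- exact: pmaj_ge0.
have -> : 2 `^ m * (M + M) * (1 + tnorm _ x) `^ (- m) =
  (2 `^ m * (1 + tnorm _ x) `^ (- m)) * (M + M) by ring.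
rewrite [leRHS]EFinM; apply: lee_wpmul2l.
  by rewrite lee_fin; apply: mulr_ge0; exact: powR_ge0.
by rewrite EFinD; apply: leeD.
Qed.

End KernelIntegral.

(** * Measurability of the kernels and the Green potential *)

Section Kernels.
Context {R : realType} (N : nat).
Implicit Types x y z : pt R N.

Lemma kerk_ge0 k (y z : (N.-1).-tuple R) : (0 <= @kerk R N k y z)%E.
Proof.
by rewrite /kerk; case: ifP => // _; rewrite lee_fin invr_ge0; exact: powR_ge0.
Qed.

Lemma kerN_ge0 x (y' : (N.-1).-tuple R) : (0 <= kerN x y')%E.
Proof.
rewrite /kerN; case: ifP => // _; rewrite lee_fin invr_ge0 exprn_ge0//.
exact: pdist_ge0.
Qed.

Lemma kerN_boundary (a b : (N.-1).-tuple R) :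
  kerN (a, 0) b = kerk (N - 2)%:R a b.
Proof.
rewrite /kerN /kerk xpair_eqE eqxx andbT; case: ifP => // _.
by rewrite pdist_boundary powR_mulrn// tdist_ge0.
Qed.

(** Dropping the height of [x] only shortens the distance, so estimates for the boundary kernel of
    exponent N - 2 = n - 1 hold at every height. *)
Lemma kerN_le x (y' : (N.-1).-tuple R) : (kerN x y' <= kerk (N - 2)%:R x.1 y')%E.
Proof.
rewrite -kerN_boundary /kerN xpair_eqE eqxx andbT.
have [_|xy] := eqVneq x.1 y'; first by rewrite leey.
have xy' : x != (y', 0) by apply: contra xy => /eqP ->.
rewrite (negbTE xy') lee_fin pdist_boundary.
have t0 := tdist_gt0 _ _ _ xy; have tp := le_tdist_pdist _ x (y', 0).
rewrite lef_pV2 ?posrE ?exprn_gt0//; first by rewrite lerXn2r ?nnegrE// ltW// (lt_le_trans t0).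
exact: lt_le_trans tp.
Qed.

Lemma kerN_interior x (y' : (N.-1).-tuple R) : 0 < x.2 ->
  kerN x y' = ((pdist x (y', 0) ^+ (N - 2))^-1)%:E.
Proof.
move=> x0; rewrite /kerN; case: eqP => // xy; by move: x0; rewrite xy ltxx.
Qed.

Lemma measurable_kerk d (T : measurableType d) k (f g : T -> (N.-1).-tuple R) :
  measurable_fun setT f -> measurable_fun setT g ->
  measurable_fun setT (fun t => @kerk R N k (f t) (g t)).
Proof.
move=> mf mg; have mt := measurable_tdist _ _ _ f g mf mg.
rewrite (_ : (fun t => _) = fun t => if tdist (f t) (g t) == 0 then +oo%E
    else ((tdist (f t) (g t) `^ k)^-1)%:E); last first.
  apply/funext => t; rewrite /kerk; have [->|ne] := eqVneq (f t) (g t).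
    by rewrite tdist_xx eqxx.
  by rewrite gt_eqF// tdist_gt0.
apply: measurable_fun_ifT.
- by apply: measurable_fun_eqr.
- exact: measurable_cst.
- apply/measurable_EFinP; under eq_fun do rewrite -powRN.
  exact: (measurableT_comp (measurable_powR (- k)) mt).
Qed.

Lemma measurable_invX d (T : measurableType d) (f : T -> R) n :
  (forall t, 0 <= f t) -> measurable_fun setT f ->
  measurable_fun setT (fun t => (f t ^+ n)^-1).
Proof.
move=> f0 mf; rewrite (_ : (fun t => _) = fun t => f t `^ (- n%:R)).
  exact: (measurableT_comp (measurable_powR _) mf).
by apply/funext => t; rewrite powRN powR_mulrn.
Qed.

Lemma measurable_pair0 d (T : measurableType d) (g : T -> (N.-1).-tuple R) :
  measurable_fun setT g -> measurable_fun setT (fun t => (g t, 0) : pt R N).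
Proof.
by move=> mg; apply: measurable_fun_pair => //; exact: measurable_cst.
Qed.

Lemma measurable_kerN d (T : measurableType d) (f : T -> pt R N)
    (g : T -> (N.-1).-tuple R) :
  measurable_fun setT f -> measurable_fun setT g ->
  measurable_fun setT (fun t => kerN (f t) (g t)).
Proof.
move=> mf mg.
have mt := measurable_pdist N _ _ _ _ mf (measurable_pair0 _ _ _ mg).
rewrite (_ : (fun t => _) = fun t => if pdist (f t) (g t, 0) == 0 then +oo%E
    else ((pdist (f t) (g t, 0) ^+ (N - 2))^-1)%:E); last first.
  apply/funext => t; rewrite /kerN; have [->|ne] := eqVneq (f t) (g t, 0).
    by rewrite pdist_boundary tdist_xx eqxx.
  by rewrite gt_eqF//; exact: pdist_gt0.
apply: measurable_fun_ifT.
- by apply: measurable_fun_eqr.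
- exact: measurable_cst.
- apply/measurable_EFinP; apply: measurable_invX => // t; exact: pdist_ge0.
Qed.

Lemma measurable_Phi d (T : measurableType d) (f g : T -> pt R N) :
  measurable_fun setT f -> measurable_fun setT g ->
  measurable_fun setT (fun t => Phi (f t) (g t)).
Proof.
move=> mf mg; have mt := measurable_pdist N _ _ _ _ mf mg.
rewrite (_ : (fun t => _) = fun t => if pdist (f t) (g t) == 0 then +oo%E
    else ((((N - 2)%:R * sigmaN R N)^-1 * (pdist (f t) (g t) ^+ (N - 2))^-1))%:E);
  last first.
  apply/funext => t; rewrite /Phi; have [->|ne] := eqVneq (f t) (g t).
    suff -> : pdist (g t) (g t) = 0 by rewrite eqxx.
    apply/le_anti; rewrite pdist_ge0 andbT.
    by apply: le_trans (pdist_le _ _ _) _; rewrite tdist_xx subrr normr0 addr0.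
  by rewrite gt_eqF//; exact: pdist_gt0.
apply: measurable_fun_ifT.
- by apply: measurable_fun_eqr.
- exact: measurable_cst.
- apply/measurable_EFinP; apply: measurable_funM; first exact: measurable_cst.
  apply: measurable_invX => // t; exact: pdist_ge0.
Qed.

Lemma measurable_reflect d (T : measurableType d) (f : T -> pt R N) :
  measurable_fun setT f -> measurable_fun setT (fun t => reflect_pt (f t)).
Proof.
move=> mf; apply: measurable_fun_pair; first exact: (measurableT_comp measurable_fst mf).
by apply: measurable_funN; exact: (measurableT_comp measurable_snd mf).
Qed.

Lemma measurable_Green d (T : measurableType d) (f g : T -> pt R N) :
  measurable_fun setT f -> measurable_fun setT g ->
  measurable_fun setT (fun t => Green (f t) (g t)).
Proof.
move=> mf mg; apply: emeasurable_funD; apply: measurable_Phi => //.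
exact: measurable_reflect.
Qed.

(** The volume of the ball must be bounded from both sides, since [fine] would send an infinite
    volume to 0. *)
Lemma sigmaN_gt0 : (0 < N)%N -> 0 < sigmaN R N.
Proof.
move=> N0; rewrite /sigmaN mulr_gt0 ?ltr0n//.
set n := N.-1; set f := (fun x : pt R N => _).
have f0 x : (0 <= f x)%E by rewrite lee_fin.
apply: fine_gt0; apply/andP; split.
  (* The points of the cube [0, l]^N have norm at most (n + 1) l < 1. *)
  pose l : R := (n.+2%:R)^-1.
  have l0 : 0 < l by rewrite invr_gt0 ltr0n.
  apply: (@lt_le_trans _ _ ((l * l ^+ n)%:E)).
    by rewrite lte_fin mulr_gt0// exprn_gt0.
  apply: (le_tint_cube _ (fun=> 0) l set0); rewrite ?ltW//.
  - exact: null0.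
  - by move=> t; apply: integral_ge0.
  - move=> t tc _; rewrite -(integral_itvcc 0 l (ltW l0)).
    apply: ge0_integral_mono => s _; rewrite ?lee_fin// !indicE.
    have [/set_mem|//] := boolP (s \in _); rewrite /= in_itv/= add0r => /andP[s0 sl].
    rewrite mem_set//= pnormE; apply: le_lt_trans (pdist_le _ _ _) _.
    apply: (@le_lt_trans _ _ (n%:R * l + l)).
      apply: lerD; last by rewrite /= subr0 ger0_norm.
      apply: tdist_le => [|i]; first exact: ltW.
      by have := tc i; rewrite add0r tnth_origin subr0 => /andP[t0 tl]; rewrite ger0_norm.
    have -> : n%:R * l + l = n.+1%:R * l by rewrite -[n.+1]addn1 natrD mulrDl mul1r.
    by rewrite ltr_pdivrMr ?ltr0n// mul1r ltr_nat.
(* The unit ball lies in [-1, 1]^N. *)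
apply: (@le_lt_trans _ _ (2%:E * (2 ^+ n)%:E)%E); last by rewrite -EFinM ltry.
rewrite -(tint_cube n (fun=> -1) 2)//.
rewrite -tintZl; last 3 first.
- by apply: measurable_EFin_indic; exact: measurable_cube.
- by move=> t; rewrite lee_fin.
- by rewrite lee_fin.
apply: le_tint => t; first exact: integral_ge0.
have coord (s : R) i : pnorm ((t, s) : pt R N) < 1 -> `|tnth t i| <= 1.
  move=> ts; have := le_tdist _ t (origin n) i; rewrite tnth_origin subr0 => /le_trans; apply.
  apply: le_trans (ltW ts); rewrite pnormE.
  exact: (le_tdist_pdist _ (t, s) (origin _, 0)).
rewrite indicE; have [_|] := boolP (t \in _).
  rewrite mule1 -(integral_itvcc (-1) 2)//.
  apply: ge0_integral_mono => s _; rewrite ?lee_fin// !indicE.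
  have [/set_mem /= ts|//] := boolP (_ \in [set y | pnorm y < 1]).
  rewrite mem_set//= in_itv/=.
  have := le_dist2_pdist _ (t, s) (origin _, 0); rewrite /= subr0 => h.
  have : `|s| <= 1 by apply: le_trans h _; rewrite -pnormE; exact: ltW.
  by rewrite ler_norml => /andP[]; lra.
rewrite notin_setE => tc; rewrite mule0 (_ : (fun s => _) = cst 0%E) ?integral0//.
apply/funext => s; rewrite /f indicE memNset// => /= ts; apply: tc => i.
by have := coord s i ts; rewrite ler_norml => /andP[]; lra.
Qed.

End Kernels.

(** * Support and sigma-finiteness of the measure *)

Section RadonMeasure.
Context {R : realType} (N : nat).
Variable mu : {measure set (pt R N) -> \bar R}.
Implicit Types x y z : pt R N.

Definition pball x r : set (pt R N) := [set y | pdist x y < r].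

Lemma measurable_pball x r : measurable (pball x r).
Proof.
have := @measurable_pdist R N _ (pt R N) (fun=> x) (fun y => y) (measurable_cst x)
  (@measurable_id _ _ setT).
move=> /(_ measurableT `]-oo, r[%classic (measurable_itv _)).
rewrite setTI; congr measurable; apply/seteqP; split=> y /=; by rewrite in_itv.
Qed.

Definition rat_pball (c : ((N.-1).-tuple rat * rat) * rat) : set (pt R N) :=
  pball ([tuple ratr (tnth c.1.1 i) | i < N.-1], ratr c.1.2) (ratr c.2).

Lemma rat_pball_nbhs x r : 0 < r ->
  exists c, rat_pball c x /\ rat_pball c `<=` pball x r.
Proof.
(* The rational centre is within (n + 1) e = r/4 of [x] and the rational radius lies between r/4 and
   r/2, so the ball contains [x] and its points are within 3 r/4 of [x]. *)
move=> r0; pose e := r / (4 * (N.-1).+1%:R).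
have n0 : 0 < (N.-1).+1%:R :> R by rewrite ltr0n.
have e0 : 0 < e by rewrite divr_gt0// mulr_gt0.
have rx (s : R) : {q : rat | `|s - ratr q| <= e}.
  apply: cid; have /rat_in_itvoo[q] : s < s + e by rewrite ltrDl.
  by rewrite in_itv/= => /andP[q1 q2]; exists q; rewrite ler_norml; lra.
have /rat_in_itvoo[rho] : r / 4 < r / 2 by lra.
rewrite in_itv/= => /andP[rho1 rho2].
pose q := [tuple sval (rx (tnth x.1 i)) | i < N.-1].
pose c : pt R N := ([tuple ratr (tnth q i) | i < N.-1], ratr (sval (rx x.2))).
have xc : pdist x c <= r / 4.
  apply: le_trans (pdist_le _ _ _) _; apply: (@le_trans _ _ ((N.-1)%:R * e + e)).
    apply: lerD; last exact: (svalP (rx x.2)).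
    apply: tdist_le => [|i]; first exact: ltW.
    by rewrite !tnth_mktuple; exact: (svalP (rx (tnth x.1 i))).
  have -> : (N.-1)%:R * e + e = (N.-1).+1%:R * e by rewrite -natr1 mulrDl mul1r.
  rewrite /e; move: n0; set K := _%:R => K0; have -> : K * (r / (4 * K)) = r / 4.
    by field; exact: lt0r_neq0.
  by [].
exists ((q, sval (rx x.2)), rho); split.
  rewrite /rat_pball/= /pball/= pdistC; exact: le_lt_trans xc rho1.
move=> y; rewrite /rat_pball/= /pball/= => cy.
have := pdist_triangle _ x c y; move: cy; rewrite -/c; lra.
Qed.

(** Lindelöf argument: if every point had a null ball, countably many null rational balls would
    cover the space. *)
Lemma support_nonempty : mu setT <> 0%E -> exists x, in_support mu x.
Proof.
move=> mu0; apply: contrapT => /forallNP h; apply: mu0.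
have {}h x : exists2 r, 0 < r & mu (pball x r) = 0%E.
  have /existsNP[r /not_implyP[r0 /negP]] := h x.
  by rewrite -leNgt => hr; exists r => //; apply/eqP; rewrite eq_le hr/=.
pose U k := if choice.unpickle k is Some c then
  if pselect (mu (rat_pball c) = 0%E) then rat_pball c else set0 else set0.
have UT : \bigcup_k U k = setT.
  apply/seteqP; split=> // x _; have [r r0 hr] := h x.
  have [c [cx cr]] := rat_pball_nbhs x r r0.
  exists (choice.pickle c); first exact: I.
  rewrite /U choice.pickleK.
  case: pselect => // nc; exfalso; apply: nc; apply/eqP; rewrite eq_le; apply/andP; split => //.
  rewrite -hr; apply: le_measure => //; rewrite inE; exact: measurable_pball.
apply: measure_negligible => //; rewrite -UT; apply: negligible_bigcup => k.
rewrite /U; case: choice.unpickle => [c|]; last exact: negligible_set0.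
case: pselect => [c0|nc0] /=; last exact: negligible_set0.
apply/negligibleP => //; exact: measurable_pball.
Qed.

Hypothesis muf : locally_finite mu.

Lemma locally_finite_sigma_finite : sigma_finite setT mu.
Proof.
exists (fun k : nat => pball (origin _, 0) k.+1%:R).
  apply/seteqP; split=> // x _; exists (Num.truncn (pdist (origin _, 0) x)) => //.
  exact: truncnS_gt.
move=> k; split; first exact: measurable_pball.
rewrite (_ : pball _ _ = [set y | (pnorm y < k.+1%:R)%R]); first by apply: muf; rewrite ltr0n.
by apply/seteqP; split=> y; rewrite /pball/= pnormE pdistC.
Qed.

End RadonMeasure.

Section SigmaFinite.
Context {R : realType} (N : nat) (mu : {measure set (pt R N) -> \bar R}).
Hypothesis muf : locally_finite mu.

(** A copy of [mu] able to carry the sigma-finite instance that Tonelli requires. *)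
Let nu : set (pt R N) -> \bar R := mu.
HB.instance Definition _ := Measure.on nu.
HB.instance Definition _ := @Measure_isSigmaFinite.Build _ _ _ nu
  (locally_finite_sigma_finite N mu muf).

Lemma measurable_integral_param d (T : measurableType d) (D : set (pt R N))
    (f : T * pt R N -> \bar R) :
  measurable D -> measurable_fun setT f -> (forall z, 0 <= f z)%E ->
  measurable_fun setT (fun x => \int[mu]_(y in D) f (x, y))%E.
Proof.
move=> mD mf f0.
rewrite (_ : (fun x => _) = (fun x => \int[nu]_y (f (x, y) * (\1_D y)%:E))%E); last first.
  apply/funext => x; rewrite integral_mkcond; apply: eq_integral => y _.
  rewrite /patch indicE; case: ifP => _; by rewrite ?mule1 ?mule0.
apply: (@measurable_fun_fubini_tonelli_F _ _ _ _ _ nu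
  (fun z : T * pt R N => f z * (\1_D z.2)%:E)%E).
- apply: emeasurable_funM => //; apply/measurable_EFinP.
  have mi : measurable_fun setT (\1_D : pt R N -> R) by exact: measurable_indic.
  have := measurableT_comp mi (@measurable_snd _ _ T (pt R N)); exact.
- by move=> z; rewrite mule_ge0// lee_fin.
Qed.

End SigmaFinite.

(** * Green potential of the measure *)

Section GreenPotential.
Context {R : realType} (N : nat).
Variable mu : {measure set (pt R N) -> \bar R}.
Hypothesis N3 : (3 <= N)%N.
Implicit Types x y z : pt R N.
Local Notation H := (@halfspace R N).
Local Notation m := (N - 2)%N.
Local Notation kap := (((N - 2)%:R * sigmaN R N)^-1).

Lemma kap_gt0 : 0 < kap.
Proof.
rewrite invr_gt0 mulr_gt0 ?ltr0n ?subn_gt0//; apply: sigmaN_gt0; exact: leq_trans N3.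
Qed.

Lemma measurable_halfspace : measurable H.
Proof.
have := @measurable_snd _ _ ((N.-1).-tuple R) R measurableT `]0, +oo[%classic
  (measurable_itv _).
rewrite setTI; congr measurable; apply/seteqP; split=> y /=; by rewrite in_itv/= andbT.
Qed.

Lemma Phi_ge0 x y : (0 <= Phi x y)%E.
Proof.
rewrite /Phi; case: ifP => // _; rewrite lee_fin mulr_ge0//; first exact: ltW kap_gt0.
by rewrite invr_ge0 exprn_ge0//; exact: pdist_ge0.
Qed.

Lemma Green_ge0 x y : (0 <= Green x y)%E.
Proof. by rewrite /Green adde_ge0// Phi_ge0. Qed.

Lemma measurable_Phix x : measurable_fun setT (Phi x).
Proof. by apply: measurable_Phi => //; exact: measurable_cst. Qed.

Lemma measurable_Greenx x : measurable_fun setT (Green x).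
Proof. by apply: measurable_Green => //; exact: measurable_cst. Qed.

Lemma Phi_ge x y D : 0 < D -> pdist x y <= D -> ((kap * (D ^+ m)^-1)%:E <= Phi x y)%E.
Proof.
move=> D0 xyD; rewrite /Phi; have [_|xy] := eqVneq x y; first by rewrite leey.
have p0 := pdist_gt0 _ _ _ xy; rewrite lee_fin; apply: ler_wpM2l; first exact: ltW kap_gt0.
by rewrite lef_pV2 ?posrE ?exprn_gt0// lerXn2r// nnegrE ltW.
Qed.

(** Comparable distances give comparable values of the fundamental solution. At the singularity x =
    y the assumption forces z = y, and both sides are infinite. *)
Lemma Phi_scale x y z c : 0 < c -> pdist z y <= c * pdist x y ->
  (Phi x y <= (c ^+ m)%:E * Phi z y)%E.
Proof.
move=> c0 zyx; have [xy|xy] := eqVneq x y.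
  move: zyx; rewrite xy; have -> : pdist y y = 0.
    by apply/le_anti; rewrite pdist_ge0 andbT; apply: le_trans (pdist_le _ _ _) _;
      rewrite tdist_xx subrr normr0 addr0.
  rewrite mulr0; have [->|/pdist_gt0] := eqVneq z y; last by move=> /lt_le_trans h /h; rewrite ltxx.
  by rewrite /Phi eqxx gt0_muley// lte_fin exprn_gt0.
have p0 := pdist_gt0 _ _ _ xy.
apply: (@le_trans _ _ ((c ^+ m)%:E * (kap * ((c * pdist x y) ^+ m)^-1)%:E)%E).
  rewrite /Phi (negbTE xy) -EFinM lee_fin exprMn (invfM (c ^+ m)) [leRHS]mulrCA mulVKf//.
  by rewrite gt_eqF// exprn_gt0.
apply: lee_wpmul2l; first by rewrite lee_fin exprn_ge0// ltW.
by apply: Phi_ge => //; exact: mulr_gt0.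
Qed.

Lemma ae_integral_scale (A : set (pt R N)) D (f g : pt R N -> \bar R) c :
  0 <= c -> measurable D -> measurable A -> mu A = 0%E ->
  measurable_fun setT f -> measurable_fun setT g ->
  (forall y, 0 <= f y)%E -> (forall y, 0 <= g y)%E ->
  (forall y, ~ A y -> f y <= c%:E * g y)%E ->
  (\int[mu]_(y in D) f y <= c%:E * \int[mu]_(y in D) g y)%E.
Proof.
move=> c0 mD mA A0 mf mg f0 g0 fg.
have mfD := @measurable_funTS _ _ _ _ D f mf; have mgD := @measurable_funTS _ _ _ _ D g mg.
rewrite -ge0_integralZl_EFin//; apply: ae_ge0_le_integral => //.
- by move=> y _; rewrite mule_ge0.
- exact: measurable_funeM.
- exists A; split => // y /= /not_implyP[Dy]; apply: contra_notP; exact: fg.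
Qed.

Lemma support_pball : mu setT <> 0%E -> (forall x, in_support mu x -> 0 < x.2) ->
  exists x r, [/\ 0 < r, pball N x r `<=` H & (0 < mu (pball N x r))%E].
Proof.
move=> mu0 supp; have [x sx] := support_nonempty _ _ mu0.
(* With the height of [x] as radius the ball stays in the half space. *)
have x0 := supp _ sx; exists x, x.2; split => //; last exact: sx.
move=> y; rewrite /pball/= => xy; have := le_dist2_pdist _ x y.
by rewrite /halfspace/= ler_norml => /andP[]; lra.
Qed.

Lemma Green_integral_ge : mu setT <> 0%E -> (forall x, in_support mu x -> 0 < x.2) ->
  exists2 c : R, 0 < c & forall z,
    ((c * (1 + pnorm z) `^ (- m%:R))%:E <= \int[mu]_(y in H) Green z y)%E.
Proof.
move=> mu0 supp; have [x [r [r0 xH mux]]] := support_pball mu0 supp.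
(* The value 1 is the real lower bound when the ball has infinite mass. *)
have [mass mass0 massle] : exists2 a : R, 0 < a & (a%:E <= mu (pball N x r))%E.
  case: (mu (pball N x r)) mux => [a|_|//]; first by rewrite lte_fin; exists a.
  by exists 1 => //; rewrite leey.
(* For [y] in the ball, |z - y| <= |z| + |x| + r <= K (1 + |z|). *)
pose K := 1 + pnorm x + r.
have x0 := pnorm_ge0 _ x; have K0 : 0 < K by rewrite /K; lra.
exists (kap * (K ^+ m)^-1 * mass).
  by apply: mulr_gt0 => //; apply: mulr_gt0; [exact: kap_gt0|rewrite invr_gt0 exprn_gt0].
move=> z; have z0 := pnorm_ge0 _ z.
have Z0 : 0 < 1 + pnorm z by lra.
pose c := kap * ((K * (1 + pnorm z)) ^+ m)^-1.
have c0 : 0 <= c.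
  by apply: mulr_ge0; [exact: ltW kap_gt0|rewrite invr_ge0 exprn_ge0// mulr_ge0// ltW].
have -> : kap * (K ^+ m)^-1 * mass * (1 + pnorm z) `^ (- m%:R) = c * mass.
  by rewrite /c powRN powR_mulrn ?(ltW Z0)// exprMn (invfM (K ^+ m)); ring.
apply: (@le_trans _ _ (\int[mu]_(y in H) (c%:E * (\1_(pball N x r) y : R)%:E))%E).
  rewrite ge0_integralZl_EFin//; last 2 first.
  - exact: measurable_halfspace.
  - by apply: measurable_funTS; apply: measurable_EFin_indic; exact: measurable_pball.
  rewrite integral_indic; [|exact: measurable_halfspace|exact: measurable_pball].
  rewrite (setIidl xH) EFinM; exact: lee_wpmul2l.
apply: ge0_integral_mono => y _; first by rewrite mule_ge0// lee_fin.
rewrite indicE; have [/set_mem|_] := boolP (y \in _); last by rewrite mule0 Green_ge0.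
rewrite /pball/= => xy; rewrite mule1; apply: (@le_trans _ _ (Phi z y)).
  apply: Phi_ge; first exact: mulr_gt0.
  have := pdist_triangle _ z x y; have := pdist_triangle _ z (origin _, 0) x.
  rewrite [pdist (_, _) x]pdistC -!pnormE /K.
  have := mulr_ge0 x0 z0; have := mulr_ge0 (ltW r0) z0; lra.
by rewrite /Green leeDl// Phi_ge0.
Qed.

Lemma Green_integral_gt0 : mu setT <> 0%E -> (forall x, in_support mu x -> 0 < x.2) ->
  forall z, (0 < \int[mu]_(y in H) Green z y)%E.
Proof.
move=> mu0 supp z; have [c c0 h] := Green_integral_ge mu0 supp.
apply: lt_le_trans (h z); rewrite lte_fin mulr_gt0// powR_gt0//.
by have := pnorm_ge0 _ z; lra.
Qed.

Hypothesis Ufin : forall x, (Upot mu x < +oo)%E.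

Lemma Green_integral_le x :
  (\int[mu]_(y in H) Green x y <= Upot mu x + Upot mu (reflect_pt x))%E.
Proof.
rewrite /Upot -ge0_integralD//; last 4 first.
- by move=> y _; exact: Phi_ge0.
- exact: measurable_Phix.
- by move=> y _; exact: Phi_ge0.
- exact: measurable_Phix.
apply: ge0_subset_integral => //.
- exact: measurable_halfspace.
- exact: measurable_Greenx.
- by move=> y _; exact: Green_ge0.
Qed.

Definition Gpot x : R := fine (\int[mu]_(y in H) Green x y).

Lemma GpotE x : (\int[mu]_(y in H) Green x y = (Gpot x)%:E)%E.
Proof.
rewrite /Gpot fineK// ge0_fin_numE; last by apply: integral_ge0 => y _; exact: Green_ge0.
by apply: le_lt_trans (Green_integral_le x) _; rewrite lte_add_pinfty.
Qed.

Lemma Gpot_ge0 x : 0 <= Gpot x.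
Proof. by apply: fine_ge0; apply: integral_ge0 => y _; exact: Green_ge0. Qed.

Hypothesis supp : forall x, in_support mu x -> 0 < x.2.

Lemma null_pball x : x.2 <= 0 -> exists2 r, 0 < r & mu (pball N x r) = 0%E.
Proof.
move=> x0; have /existsNP[r /not_implyP[r0 /negP]] : ~ in_support mu x.
  by move=> /supp; rewrite ltNge x0.
by rewrite -leNgt => hr; exists r => //; apply/eqP; rewrite eq_le hr/=.
Qed.

Lemma reflect_boundary (a : (N.-1).-tuple R) : reflect_pt (a, 0) = ((a, 0) : pt R N).
Proof. by rewrite /reflect_pt/= oppr0. Qed.

(** For [y] outside the null ball, |z - y| <= |z - x| + |x - y| <= 2 |x - y|. *)
Lemma Upot_near x r z : 0 < r -> mu (pball N x r) = 0%E -> pdist z x < r ->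
  (Upot mu x <= (2 ^+ m)%:E * Upot mu z)%E.
Proof.
move=> r0 mux zx; apply: (ae_integral_scale _ _ _ _ _ _ _ (measurable_pball _ x r)) => //.
- exact: measurable_Phix.
- exact: measurable_Phix.
- exact: Phi_ge0.
- exact: Phi_ge0.
move=> y /negP; rewrite -leNgt => ry; apply: Phi_scale => //.
have := pdist_triangle _ z x y; lra.
Qed.

(** For [y] outside the null ball of centre x = (a, 0), |z - y| lies between (1 - th) |x - y| and (1
    + th) |x - y|. The reflection of [z] obeys the same bounds because x is a fixed point. Letting
    th tend to 0 will give continuity at x. *)
Lemma Gpot_near (a : (N.-1).-tuple R) r th z : 0 < r -> mu (pball N (a, 0) r) = 0%E ->
  0 <= th -> th < 1 -> pdist z (a, 0) <= th * r ->
  (1 - th) ^+ m * Gpot z <= Gpot (a, 0) /\ Gpot (a, 0) <= (1 + th) ^+ m * Gpot z.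
Proof.
move=> r0 mua th0 th1 za; set x : pt R N := (a, 0).
have t1 : 0 < 1 - th by rewrite subr_gt0.
have t2 : 0 < 1 + th by lra.
have zra : pdist (reflect_pt z) x <= th * r.
  by rewrite /x -reflect_boundary pdist_reflect.
have near w : pdist w x <= th * r -> forall y, ~ pball N x r y ->
    (Phi w y <= ((1 - th) ^- m)%:E * Phi x y)%E /\
    (Phi x y <= ((1 + th) ^+ m)%:E * Phi w y)%E.
  move=> wx y /negP; rewrite -leNgt => ry; split.
    rewrite -exprVn; apply: Phi_scale; first by rewrite invr_gt0.
    rewrite ler_pdivlMl//.
    have := pdist_triangle _ x w y; rewrite (pdistC _ x w).
    have : th * r <= th * pdist x y by apply: ler_wpM2l.
    have : pdist x y <= pdist w x + pdist w y.
      by rewrite (pdistC _ w x); exact: pdist_triangle.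
    lra.
  apply: Phi_scale => //; have := pdist_triangle _ w x y.
  have : th * r <= th * pdist x y by apply: ler_wpM2l.
  lra.
split.
- rewrite -ler_pdivlMl ?exprn_gt0// -lee_fin EFinM -(GpotE z) -(GpotE x).
  apply: (ae_integral_scale _ _ _ _ _ _ _ (measurable_pball _ x r)) => //.
  + by rewrite invr_ge0 exprn_ge0// ltW.
  + exact: measurable_halfspace.
  + exact: measurable_Greenx.
  + exact: measurable_Greenx.
  + exact: Green_ge0.
  + exact: Green_ge0.
  move=> y ny; rewrite /Green reflect_boundary ge0_muleDr ?Phi_ge0//.
  by apply: leeD; [exact: (near _ za _ ny).1|exact: (near _ zra _ ny).1].
- rewrite -lee_fin EFinM -(GpotE z) -(GpotE x).
  apply: (ae_integral_scale _ _ _ _ _ _ _ (measurable_pball _ x r)) => //.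
  + by rewrite exprn_ge0// ltW.
  + exact: measurable_halfspace.
  + exact: measurable_Greenx.
  + exact: measurable_Greenx.
  + exact: Green_ge0.
  + exact: Green_ge0.
  move=> y ny; rewrite /Green reflect_boundary ge0_muleDr ?Phi_ge0//.
  by apply: leeD; [exact: (near _ za _ ny).2|exact: (near _ zra _ ny).2].
Qed.

End GreenPotential.

(** * Nonexistence *)

Section Nonexistence.
Context {R : realType} (N : nat).
Variable mu : {measure set (pt R N) -> \bar R}.
Variables (k p lam : R) (u : pt R N -> R) (ut : (N.-1).-tuple R -> R).
Hypothesis N3 : (3 <= N)%N.
Hypothesis k0 : 0 < k.
Hypothesis p0 : 0 < p.
Hypothesis lam0 : 0 < lam.
Local Notation H := (@halfspace R N).
Local Notation n := (N.-1).

Variable B : set (n.-tuple R).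
Hypothesis nullB : null _ B.
Hypothesis traceB : forall x', ~ B x' -> forall e, 0 < e -> exists2 d, 0 < d &
  forall z : pt R N, 0 < z.2 -> pdist z (x', 0) < d -> `|u z - ut x'| < e.

Hypothesis sol : ae_RNp (fun x : pt R N => (u x)%:E =
     (\int[mu]_(y in H) Green x y +
      ((2 * lam) / ((N - 2)%:R * sigmaN R N))%:E *
        tint (fun y => tint (fun z => (ut z `^ p)%:E * kerN x y * kerk k y z)))%E).

(** The bound is asked off the fixed set [B] outside which the trace is a limit, so the exceptional
    set does not grow along the iteration. *)
Definition trace_bound a := exists2 c : R, 0 < c &
  forall x', ~ B x' -> c * (1 + tnorm _ x') `^ (- a) <= ut x'.

(** Points [z] obeying the interior bound exist arbitrarily close to [(x', 0)], and [ut x'] is the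
    limit of [u] there. Within distance 1 one has 1 + |z| <= 2 (1 + |x'|), which costs the factor
    2^(-a). *)
Lemma trace_bound_of_ae a c : 0 <= a -> 0 < c ->
  ae_RNp (fun x : pt R N => c * (1 + pnorm x) `^ (- a) <= u x) -> trace_bound a.
Proof.
move=> a0 c0 ae; exists (c * 2 `^ (- a)).
  by apply: mulr_gt0 => //; exact: powR_gt0.
move=> x' Bx'; rewrite leNgt; apply/negP => lt.
set L := c * 2 `^ (- a) * _ in lt.
have Lu : 0 < L - ut x' by rewrite subr_gt0.
have [d d0 hd] := traceB _ Bx' _ Lu.
pose dd := Num.min d 1; have dd0 : 0 < dd by rewrite lt_min d0 ltr01.
have dd1 : dd <= 1 by rewrite ge_min lexx orbT.
have ddd : dd <= d by rewrite ge_min lexx.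
(* The box starts at height [l] to stay in the open half space; its points are within (n + 2) l < dd
   of [(x', 0)]. *)
pose l := dd / (n.+3)%:R.
have l0 : 0 < l by rewrite divr_gt0// ltr0n.
have [z [zc /andP[z2 z2'] nz]] := nullRN_cube N (tnth x') l l _ l0 ae.
have z0 : 0 < z.2 by exact: lt_le_trans z2.
have uz : c * (1 + pnorm z) `^ (- a) <= u z by apply: contrapT => h; apply: nz.
have zx : pdist z (x', 0) < dd.
  apply: le_lt_trans (pdist_le _ _ _) _; rewrite /= subr0 (gtr0_norm z0).
  apply: (@le_lt_trans _ _ (n%:R * l + (l + l))).
    apply: lerD => //; apply: tdist_le => [|i]; first exact: ltW.
    by have := zc i => /andP[h1 h2]; rewrite ger0_norm ?subr_ge0// lerBlDl.
  have -> : n%:R * l + (l + l) = n.+2%:R * l by rewrite -[n.+2]addn2 natrD mulrDl; ring.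
  by rewrite /l mulrCA gtr_pMr// ltr_pdivrMr ?ltr0n// mul1r ltr_nat.
have : `|u z - ut x'| < L - ut x' by apply: hd => //; exact: lt_le_trans ddd.
apply/negP; rewrite -leNgt; apply: le_trans (ler_norm _); rewrite lerD2r.
apply: le_trans uz; rewrite /L -mulrA; apply: ler_wpM2l; first exact: ltW.
have t0 := tnorm_ge0 _ x'; have zn := pnorm_ge0 _ z.
rewrite -powRM//; last by lra.
apply: le_powRN => //; first lra.
have := pdist_triangle _ z (x', 0) (origin _, 0); rewrite -!pnormE pnorm_boundary; lra.
Qed.

Local Notation K := (2 * n%:R + 1 : R).

Lemma K_ge1 : 1 <= K. Proof. by rewrite lerDr mulr_ge0. Qed.

Lemma tnorm_cube (t : n.-tuple R) r : 0 <= r -> cube _ (fun=> r) r t ->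
  tnorm _ t <= 2 * n%:R * r.
Proof.
move=> r0 tc; have -> : 2 * n%:R * r = n%:R * (r + r) by ring.
apply: tdist_le => [|i]; first by rewrite addr_ge0.
rewrite tnth_origin subr0; have /andP[h1 h2] := tc i.
by rewrite ger0_norm//; exact: le_trans h1.
Qed.

(** On the cube [rho, 2 rho]^n, of volume rho^n, both 1 + |z| <= K rho and |y - z| <= K sig hold
    with K = 2 n + 1. The constant [kap] will be a lower bound of the single layer kernel. *)
Lemma inner_lower a c : 0 <= a -> 0 < c ->
  (forall x', ~ B x' -> c * (1 + tnorm _ x') `^ (- a) <= ut x') ->
  forall kap y rho sig, 0 <= kap -> 1 <= rho -> rho <= sig -> 1 + tnorm _ y <= sig ->
  ((kap * (c `^ p * K `^ (- (a * p + k)) * sig `^ (- k) * rho `^ (n%:R - a * p)))%:E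
    <= tint (fun z => (ut z `^ p)%:E * kap%:E * kerk k y z))%E.
Proof.
move=> a0 c0 lb kap y rho sig kap0 rho1 rs ys.
have rho0 : 0 < rho by exact: lt_le_trans rho1.
have sig0 : 0 < sig by exact: lt_le_trans rs.
have K0 : 0 < K by exact: lt_le_trans K_ge1.
have y0 := tnorm_ge0 _ y.
have n0 : 0 <= n%:R :> R by [].
have -> : kap * (c `^ p * K `^ (- (a * p + k)) * sig `^ (- k) * rho `^ (n%:R - a * p)) =
   ((c `^ p * (K * rho) `^ (- (a * p))) * kap * (K * sig) `^ (- k)) * rho ^+ n.
  rewrite !powRM ?(ltW K0) ?(ltW rho0) ?(ltW sig0)// opprD (powRD_gt0 _ K _ _ K0).
  by rewrite (powRD_gt0 _ rho _ _ rho0) powR_mulrn ?(ltW rho0)//; ring.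
apply: (le_tint_cube _ (fun=> rho) rho B) => //.
- exact: ltW.
- by rewrite !mulr_ge0// powR_ge0.
- by move=> t; rewrite !mule_ge0 ?lee_fin ?powR_ge0 ?kerk_ge0.
move=> t tc Bt; have tn := tnorm_cube t rho (ltW rho0) tc.
rewrite !EFinM; apply: lee_pmul.
- by rewrite -!EFinM lee_fin !mulr_ge0// powR_ge0.
- by rewrite lee_fin powR_ge0.
- apply: lee_pmul => //; rewrite ?lee_fin ?mulr_ge0 ?powR_ge0//.
  have t0 := tnorm_ge0 _ t.
  rewrite -[- (a * p)]mulNr powRrM -powRM ?powR_ge0 ?(ltW c0)//.
  have h1 : c * (K * rho) `^ (- a) <= ut t.
    apply: le_trans (lb _ Bt); apply: ler_wpM2l; first exact: ltW.
    by apply: le_powRN => //; lra.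
  have h0 : 0 <= c * (K * rho) `^ (- a) by rewrite mulr_ge0 ?powR_ge0 ?ltW.
  by apply: ge0_ler_powR; rewrite ?nnegrE ?(ltW p0)//; exact: le_trans h1.
- rewrite /kerk; have [_|yt] := eqVneq y t; first by rewrite leey.
  rewrite lee_fin -powRN; apply: le_powRN; [exact: tdist_gt0| |exact: ltW].
  have := tdist_triangle _ y (origin _) t; rewrite (tdistC _ (origin _)).
  have : n%:R * rho <= n%:R * sig by exact: ler_wpM2l.
  rewrite -/(tnorm _ t) -/(tnorm _ y); lra.
Qed.

(** The radius [rho] is free above 1 + |y|: for a = 0 and k < n, letting it grow makes H_u
    infinite. *)
Lemma Hu_lower a : 0 <= a -> trace_bound a -> exists2 c : R, 0 < c &
  forall y rho, 1 + tnorm _ y <= rho ->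
    ((c * rho `^ (n%:R - a * p - k))%:E <= Hu k p ut y)%E.
Proof.
move=> a0 [c c0 lb]; have K0 : 0 < K by exact: lt_le_trans K_ge1.
exists (c `^ p * K `^ (- (a * p + k))).
  by apply: mulr_gt0; exact: powR_gt0.
move=> y rho yr; have r1 : 1 <= rho by have := tnorm_ge0 _ y; lra.
have r0 : 0 < rho by exact: lt_le_trans r1.
have := inner_lower a c a0 c0 lb 1 y rho rho ler01 r1 (lexx _) yr.
rewrite mul1r (powRD_gt0 _ rho _ (- k) r0) => h; apply: le_trans (le_trans h _).
  by rewrite lee_fin le_eqVlt; apply/orP; left; apply/eqP; ring.
apply: le_tint => z; first by rewrite !mule_ge0 ?lee_fin ?powR_ge0 ?kerk_ge0.
by rewrite mule1.
Qed.

(** For [y] in [tau, 2 tau]^n the single layer kernel is at least (K tau)^(-(N - 2)), and the powers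
    of tau add up to -(N - 2) - k + n = 1 - k. The radii are quantified inside the almost everywhere
    statement because they will be chosen in terms of the point. *)
Lemma sol_lower a : 0 <= a -> trace_bound a -> exists2 c : R, 0 < c &
  ae_RNp (fun x : pt R N => forall rho tau, 1 <= rho -> rho <= tau -> 1 + pnorm x <= tau ->
    c * tau `^ (1 - k) * rho `^ (n%:R - a * p) <= u x).
Proof.
move=> a0 [c c0 lb]; have K0 : 0 < K by exact: lt_le_trans K_ge1.
have [coef coefE] : {v : R | v = 2 * lam / ((N - 2)%:R * sigmaN R N)} by eexists.
have coef0 : 0 < coef
  by rewrite coefE mulr_gt0//; [rewrite mulr_gt0|exact: (kap_gt0 N N3)].
have [c1 c1E] : {v : R | v = c `^ p * K `^ (- (a * p + k))} by eexists.
have c10 : 0 < c1 by rewrite c1E; apply: mulr_gt0; exact: powR_gt0.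
exists (coef * ((K ^+ (N - 2))^-1 * c1 * K `^ (- k))).
  apply: mulr_gt0 => //; apply: mulr_gt0; last exact: powR_gt0.
  by apply: mulr_gt0 => //; rewrite invr_gt0 exprn_gt0.
have [A [mA [subA A0]]] := sol; exists A; split => //; split => // x /= [x2 nx].
apply: subA; split => //= eq; apply: nx => rho tau rho1 rt xt.
have rho0 : 0 < rho by exact: lt_le_trans rho1.
have tau0 : 0 < tau by exact: lt_le_trans rt.
have tau1 : 1 <= tau by exact: le_trans rt.
have pn0 := pnorm_ge0 _ x.
rewrite -lee_fin eq; apply: le_trans (leeDr _ _); last first.
  by apply: integral_ge0 => y _; exact: Green_ge0.
rewrite -coefE -!mulrA EFinM; apply: lee_wpmul2l; first by rewrite lee_fin ltW.
have kk : 0 <= (K * tau) ^- (N - 2) by rewrite invr_ge0 exprn_ge0// mulr_ge0 ?ltW.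
have -> : (K ^+ (N - 2))^-1 * (c1 * (K `^ (- k) * (tau `^ (1 - k) * rho `^ (n%:R - a * p))))
  = ((K * tau) ^- (N - 2) * (c1 * (K * tau) `^ (- k) * rho `^ (n%:R - a * p))) * tau ^+ n.
  rewrite exprMn (invfM (K ^+ _)) powRM ?(ltW K0) ?(ltW tau0)//.
  rewrite (powRD_gt0 _ tau 1 _ tau0) powRr1 ?(ltW tau0)//.
  have -> : n = (N - 2).+1 by case: N N3 => [|[|[|m]]].
  have tt : tau ^+ (N - 2) != 0 by rewrite expf_neq0// gt_eqF.
  by rewrite exprS; field; rewrite tt expf_neq0// gt_eqF.
apply: (le_tint_cube _ (fun=> tau) tau set0) => //; first exact: ltW.
- by rewrite !mulr_ge0 ?powR_ge0 ?(ltW c10).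
- exact: null0.
- by move=> y; apply: tint_ge0 => z; rewrite !mule_ge0 ?lee_fin ?powR_ge0 ?kerk_ge0 ?kerN_ge0.
move=> y yc _; have yn := tnorm_cube y tau (ltW tau0) yc.
rewrite kerN_interior//.
apply: (@le_trans _ _ (tint (fun z => (ut z `^ p)%:E * ((K * tau) ^- (N - 2))%:E * kerk k y z)%E)).
  rewrite c1E; apply: inner_lower => //; last by have := tnorm_ge0 _ y; lra.
  by apply: le_trans rt _; rewrite ler_peMl ?K_ge1// ltW.
apply: le_tint => z; first by rewrite !mule_ge0 ?lee_fin ?powR_ge0 ?kerk_ge0.
apply: lee_wpmul2r; first exact: kerk_ge0.
apply: lee_wpmul2l; first by rewrite lee_fin powR_ge0.
rewrite lee_fin.
have px : 0 < pdist x (y, 0).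
  by apply: pdist_gt0; apply/eqP => xy; move: x2; rewrite xy ltxx.
rewrite lef_pV2 ?posrE ?exprn_gt0 ?mulr_gt0//.
apply: lerXn2r; rewrite ?nnegrE ?(ltW px) ?mulr_ge0 ?(ltW K0) ?(ltW tau0)//.
have := pdist_triangle _ x (origin _, 0) (y, 0).
rewrite (pdistC _ (origin _, 0)) -!pnormE pnorm_boundary; lra.
Qed.

Lemma trace_bound_step a b : 0 <= a -> 0 <= b -> trace_bound a ->
  k - 1 <= b \/ a * p + k - 1 - n%:R <= b -> trace_bound b.
Proof.
move=> a0 b0 /(sol_lower a a0)[c c0 ae] hb; apply: (trace_bound_of_ae b c) => //.
have [A [mA [subA A0]]] := ae; exists A; split => //; split => // x /= [x2 nx].
apply: subA; split => //= h; apply: nx.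
have t1 : 1 <= 1 + pnorm x by rewrite lerDl pnorm_ge0.
have t0 : 0 < 1 + pnorm x by exact: lt_le_trans t1.
case: hb => hb.
  have := h 1 (1 + pnorm x) (lexx _) t1 (lexx _); rewrite powR1 mulr1 => h'.
  apply: le_trans h'; apply: ler_wpM2l; first exact: ltW.
  by apply: ler_powR => //; lra.
have h' := h (1 + pnorm x) (1 + pnorm x) t1 (lexx _) (lexx _).
apply: le_trans h'; rewrite -mulrA -(powRD_gt0 _ _ _ _ t0); apply: ler_wpM2l; first exact: ltW.
by apply: ler_powR => //; lra.
Qed.

Lemma trace_bound_start : mu setT <> 0%E -> (forall x, in_support mu x -> 0 < x.2) ->
  trace_bound (N - 2)%:R.
Proof.
move=> mu0 supp; have [c c0 h] := Green_integral_ge N mu N3 mu0 supp.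
apply: (trace_bound_of_ae _ c) => //.
have [A [mA [subA A0]]] := sol; exists A; split => //; split => // x /= [x2 nx].
apply: subA; split => //= eq; apply: nx; rewrite -lee_fin eq.
apply: le_trans (h x) _; apply: leeDl; apply: mule_ge0.
  rewrite lee_fin; apply: mulr_ge0; last exact: ltW (kap_gt0 N N3).
  by rewrite mulr_ge0// ltW.
apply: tint_ge0 => y; apply: tint_ge0 => z.
by rewrite !mule_ge0 ?lee_fin ?powR_ge0 ?kerk_ge0 ?kerN_ge0.
Qed.

Lemma trace_bound0_absurd : k < n%:R -> trace_bound 0 ->
  ae_Rn (fun x' => (Hu k p ut x' < +oo)%E) -> False.
Proof.
move=> kn /(Hu_lower 0 (lexx _))[c c0 h] [A [mA [subA A0]]].
have [y [_ Ay]] := null_cube _ (fun=> 0) 1 A ltr01 (conj mA A0).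
have Hy : (Hu k p ut y < +oo)%E by apply: contrapT => hy; apply: Ay; exact: subA.
have H0 : (0 <= Hu k p ut y)%E.
  by apply: tint_ge0 => z; rewrite mule_ge0 ?lee_fin ?powR_ge0 ?kerk_ge0.
have [v Hv] : exists v, Hu k p ut y = v%:E.
  by exists (fine (Hu k p ut y)); rewrite fineK// ge0_fin_numE.
have nk : 0 < n%:R - k by rewrite subr_gt0.
have v0 : 0 <= v by rewrite -lee_fin -Hv.
(* With rho^(n - k) >= w the lower bound is at least v + 1, above the supposed finite value v of
   H_u. *)
pose w := (v + 1) / c.
have w0 : 0 < w by rewrite divr_gt0//; lra.
pose rho := Num.max (1 + tnorm _ y) (w `^ (n%:R - k)^-1).
have := h y rho; rewrite le_max lexx Hv lee_fin mul0r subr0 => /(_ isT).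
apply/negP; rewrite -ltNge.
apply: (@lt_le_trans _ _ (c * w)); first by rewrite /w mulrCA divff ?gt_eqF//; lra.
apply: ler_wpM2l; first exact: ltW.
apply: (@le_trans _ _ ((w `^ (n%:R - k)^-1) `^ (n%:R - k))).
  by rewrite -powRrM mulVf ?gt_eqF// powRr1// ltW.
have wp : 0 <= w `^ (n%:R - k)^-1 by exact: powR_ge0.
apply: ge0_ler_powR; rewrite ?nnegrE ?(ltW nk)//.
  by rewrite le_max wp orbT.
by rewrite le_max lexx orbT.
Qed.

End Nonexistence.

(** * Iteration of the decay exponent and the critical case *)

Section NonexistenceTheorems.
Context {R : realType} (N : nat).
Variable mu : {measure set (pt R N) -> \bar R}.
Variables (k p lam : R).
Local Notation n := (N.-1).
Hypothesis N3 : (3 <= N)%N.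
Hypothesis k0 : 0 < k.
Hypothesis kn : k < n%:R.
Hypothesis p0 : 0 < p.
Hypothesis lam0 : 0 < lam.
Hypothesis mu0 : mu setT <> 0%E.
Hypothesis supp : forall x, in_support mu x -> 0 < x.2.

(** The maximum with 0 keeps the exponent nonnegative, as the iteration requires; for k <= 1 the
    very first improvement already reaches 0. *)
Lemma solution_trace_bound (u : pt R N -> R) (ut : n.-tuple R -> R) :
  positive_solution k p lam mu u ut ->
  exists B, [/\ null n B, trace_bound N ut B (Num.max 0 (k - 1)) &
   [/\ forall a b, 0 <= a -> 0 <= b -> trace_bound N ut B a ->
      k - 1 <= b \/ a * p + k - 1 - n%:R <= b -> trace_bound N ut B b &
      ~ trace_bound N ut B 0]].
Proof.
move=> [_ [_ [[B [mB [subB B0]]] [Hfin [_ eq]]]]].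
have tB x' : ~ B x' -> forall e, 0 < e -> exists2 d, 0 < d &
    forall z : pt R N, 0 < z.2 -> pdist z (x', 0) < d -> `|u z - ut x'| < e.
  by move=> Bx; apply: contrapT => h; apply: Bx; exact: subB.
have nB : null n B by [].
exists B.
have step a b := trace_bound_step N mu k p lam u ut N3 k0 p0 lam0 B nB tB eq a b.
split => //.
  apply: (step (N - 2)%:R) => //; first by rewrite le_max lexx.
    exact: (trace_bound_start N mu k p lam u ut N3 lam0 B tB eq mu0 supp).
  by left; rewrite le_max lexx orbT.
split => // h0.
exact: (trace_bound0_absurd N k p ut k0 p0 B nB kn h0 Hfin).
Qed.

Lemma no_positive_solution : k <= 1 \/ (1 < k /\ p < n%:R / (k - 1)) ->
  ~ exists u ut, positive_solution k p lam mu u ut.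
Proof.
move=> hk [u [ut /solution_trace_bound[B [nB h1 [step h0]]]]].
case: hk => [k1|[k1 pk]].
  by apply: h0; move: h1; rewrite max_l// subr_le0.
have s0 : 0 < k - 1 by rewrite subr_gt0.
have ps : p * (k - 1) < n%:R by rewrite -ltr_pdivlMr.
move: h1; rewrite max_r ?(ltW s0)// => h1.
(* A step replaces a by a p + k - 1 - n, a decrease of n - (k - 1) - (p - 1) a. For 0 <= a <= k - 1
   this is at least n - p (k - 1) if p >= 1, and at least n - (k - 1) if p < 1. *)
pose eta := Num.min (n%:R - p * (k - 1)) (n%:R - (k - 1)).
have eta0 : 0 < eta by rewrite lt_min !subr_gt0 ps/=; apply: lt_trans kn; rewrite ltrBlDr ltrDl.
have e1 : eta <= n%:R - p * (k - 1) by rewrite ge_min lexx.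
have e2 : eta <= n%:R - (k - 1) by rewrite ge_min lexx orbT.
have it j : trace_bound N ut B (Num.max 0 (k - 1 - j%:R * eta)).
  elim: j => [|j IH]; first by rewrite mul0r subr0 max_r// ltW.
  have [a_le|a_gt] := leP (k - 1 - j%:R * eta) 0.
    by exfalso; apply: h0; move: IH; rewrite max_l.
  move: IH; rewrite max_r ?(ltW a_gt)// => IH.
  have [a aE] : {a | a = k - 1 - j%:R * eta} by eexists.
  rewrite -aE in IH a_gt.
  apply: (step a) => //; [exact: ltW|by rewrite le_max lexx|right].
  have -> : k - 1 - j.+1%:R * eta = a - eta by rewrite -natr1 aE; ring.
  rewrite le_max; apply/orP; right.
  have as_ : a <= k - 1 by rewrite aE lerBlDr lerDl mulr_ge0// ltW.
  have [p1|p1] := leP 1 p.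
    have : 0 <= (p - 1) * (k - 1 - a) by rewrite mulr_ge0// subr_ge0.
    nra.
  have : 0 <= (1 - p) * a by rewrite mulr_ge0// ?subr_ge0 ltW.
  nra.
have [j hj] : exists j, k - 1 - j%:R * eta <= 0.
  exists (Num.truncn ((k - 1) / eta)).+1.
  by rewrite subr_le0 -ler_pdivrMr//; apply: ltW; exact: truncnS_gt.
by apply: h0; move: (it j); rewrite max_l.
Qed.

Lemma tint_disjoint_sum (A : nat -> set (n.-tuple R)) (w : nat -> R) J :
  (forall j, measurable (A j)) -> (forall j, 0 <= w j) ->
  tint (fun t => (\sum_(j < J) w j * \1_(A j) t)%:E) =
  (\sum_(j < J) (w j)%:E * tint (fun t => (\1_(A j) t : R)%:E))%E.
Proof.
move=> mA w0; elim: J => [|J IH].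
  rewrite big_ord0 -[RHS](@tint0 R n); apply: eq_tint => t; by rewrite big_ord0.
rewrite big_ord_recr/= -IH -tintZl; last 3 first.
- exact: measurable_EFin_indic.
- by move=> t; rewrite lee_fin.
- by rewrite lee_fin.
rewrite -tintD.
- by apply: eq_tint => t; rewrite big_ord_recr/= EFinD EFinM.
- apply/measurable_EFinP; apply: measurable_sum => j.
  apply: measurable_funM; first exact: measurable_cst.
  exact: measurable_indic.
- by move=> t; rewrite lee_fin sumr_ge0// => j _; rewrite mulr_ge0.
- by apply: measurable_funeM; exact: measurable_EFin_indic.
- by move=> t; rewrite mule_ge0 ?lee_fin.
Qed.

(** Since p (k - 1) = n, the bound makes u^p at least a multiple of 2^(-j n) on a cube of side and
    distance comparable to 2^j. All these cubes contribute at least the same positive amount to the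
    integral, and infinitely many of them are disjoint. *)
Lemma no_Lp_solution : 1 < k -> p = n%:R / (k - 1) ->
  ~ exists u ut, positive_solution k p lam mu u ut /\
    (tint (fun x => (`|ut x| `^ p)%:E) < +oo)%E.
Proof.
move=> k1 pk [u [ut [/solution_trace_bound[B [nB h1 _]] Lp]]].
have s0 : 0 < k - 1 by rewrite subr_gt0.
have ps : (k - 1) * p = n%:R by rewrite pk mulrC divfK// gt_eqF.
move: h1; rewrite max_r ?(ltW s0)// => -[c c0 lb].
pose K : R := 2 * n%:R + 1.
have K1 : 1 <= K by rewrite lerDr mulr_ge0.
have K0 : 0 < K by exact: lt_le_trans K1.
pose e j : R := 2 ^+ j.
have e1 j : 1 <= e j by rewrite exprn_ege1// ler1n.
have e0 j : 0 < e j by exact: lt_le_trans (e1 j).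
(* The side is half of 2^j so that the cubes of different levels do not even share a face. *)
pose A j := cube n (fun=> e j) (e j / 2) `\` B.
have mA j : measurable (A j).
  by apply: measurableD; [exact: measurable_cube|case: nB].
pose w j := c `^ p * (K * e j) `^ (- n%:R).
have w0 j : 0 <= w j by rewrite mulr_ge0 ?powR_ge0.
have n0 : (0 < n)%N by case: N N3 => [|[|]].
have wA j : ((c `^ p * (2 * K) `^ (- n%:R))%:E <=
    (w j)%:E * tint (fun t => (\1_(A j) t : R)%:E))%E.
  apply: (@le_trans _ _ ((w j)%:E * (1 * (e j / 2) ^+ n)%:E)%E).
    rewrite -EFinM lee_fin mul1r /w !powRN !powR_mulrn ?mulr_ge0 ?(ltW K0) ?(ltW (e0 j))//.
    rewrite -mulrA; apply: ler_wpM2l; first exact: powR_ge0.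
    rewrite -!exprVn -exprMn le_eqVlt; apply/orP; left; apply/eqP; congr (_ ^+ _).
    by have := e0 j; set v := e j => v0; field; rewrite !gt_eqF.
  apply: lee_wpmul2l; first by rewrite lee_fin.
  apply: (le_tint_cube _ (fun=> e j) (e j / 2) B) => //.
  - by rewrite divr_ge0// ltW.
  - by move=> t tc Bt; rewrite lee_fin indicE mem_set.
have disj i j t : A i t -> A j t -> i = j.
  suff aux a b : (a < b)%N -> A a t -> A b t -> False.
    by move=> Ai Aj; case: (ltngtP i j) => // ij; exfalso;
      [exact: aux ij Ai Aj|exact: aux ij Aj Ai].
  move=> ab [ta _] [tb _].
  have /andP[_ h1] := ta (Ordinal n0); have /andP[h2 _] := tb (Ordinal n0).
  have : e a * 2 <= e b by rewrite /e -exprSr ler_weXn2l// ler1n.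
  have := e0 a; lra.
have wle j t : A j t -> w j <= `|ut t| `^ p.
  move=> [tc Bt]; have ej := e0 j.
  have tn : tnorm _ t <= n%:R * (2 * e j).
    apply: tdist_le => [|i]; first by rewrite mulr_ge0// ltW.
    rewrite tnth_origin subr0; have /andP[h1 h2] := tc i.
    by rewrite ger0_norm; lra.
  have h1 : c * (K * e j) `^ (- (k - 1)) <= `|ut t|.
    apply: le_trans (ler_norm _); apply: le_trans (lb _ Bt).
    apply: ler_wpM2l; first exact: ltW.
    apply: le_powRN; [by have := tnorm_ge0 _ t; lra| |exact: ltW].
    by have := e1 j; rewrite /K; lra.
  have h0 : 0 <= c * (K * e j) `^ (- (k - 1)) by rewrite mulr_ge0 ?powR_ge0 ?ltW.
  rewrite /w -ps -mulNr powRrM -powRM ?powR_ge0 ?(ltW c0)//.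
  by apply: ge0_ler_powR; rewrite ?nnegrE ?(ltW p0).
have bound J : ((J%:R * (c `^ p * (2 * K) `^ (- n%:R)))%:E <=
    tint (fun x => (`|ut x| `^ p)%:E))%E.
  apply: (@le_trans _ _ (tint (fun t => (\sum_(j < J) w j * \1_(A j) t)%:E))).
    rewrite tint_disjoint_sum//.
    have -> : (J%:R * (c `^ p * (2 * K) `^ (- n%:R)))%:E =
        (\sum_(j < J) (c `^ p * (2 * K) `^ (- n%:R))%:E)%E.
      by rewrite sumEFin sumr_const card_ord mulr_natl.
    by apply: lee_sum => j _.
  apply: le_tint => t.
    by rewrite lee_fin sumr_ge0// => j _; rewrite mulr_ge0.
  rewrite lee_fin; have [[i Ai]|nA] := pselect (exists i : 'I_J, A i t).
    rewrite (bigD1 i)//= big1 ?addr0; last first.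
      move=> j ji; rewrite indicE memNset ?mulr0// => Aj.
      by move/eqP: ji; apply; apply: val_inj; exact: disj Aj Ai.
    by rewrite indicE mem_set// mulr1; exact: wle Ai.
  rewrite big1 ?powR_ge0// => j _; rewrite indicE memNset ?mulr0// => Aj.
  by apply: nA; exists j.
have C0 : 0 < c `^ p * (2 * K) `^ (- n%:R) by rewrite mulr_gt0// powR_gt0// mulr_gt0.
have T0 : (0 <= tint (fun x => (`|ut x| `^ p)%:E))%E.
  by apply: tint_ge0 => t; rewrite lee_fin powR_ge0.
move: Lp bound; case: (tint _) T0 => // v _ _ bound.
set C := _ * _ in C0 bound.
have := bound (Num.truncn (v / C)).+1; rewrite lee_fin; apply/negP; rewrite -ltNge.
by rewrite -ltr_pdivrMr//; exact: truncnS_gt.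
Qed.

End NonexistenceTheorems.

(** * Boundary behaviour of the Green potential *)

Section RealInequalities.
Context {R : realType}.

Lemma bernoulli_le (t : R) m : 0 <= t -> t <= 1 -> 1 - m%:R * t <= (1 - t) ^+ m.
Proof.
move=> t0 t1; elim: m => [|m IH]; first by rewrite mul0r subr0 expr0.
rewrite exprS; apply: (@le_trans _ _ ((1 - t) * (1 - m%:R * t))).
  have := mulr_ge0 (ler0n R m) (sqr_ge0 t); rewrite -natr1; nra.
by apply: ler_wpM2l => //; rewrite subr_ge0.
Qed.

(** With t = 1 - a/b, Bernoulli gives b^(-m) = a^(-m) (1 - t)^m >= a^(-m) (1 - m t), and t <= t^g <=
    (D/a)^g because 0 <= t <= 1 and b >= a. *)
Lemma inv_pow_holder (a b D g : R) m : 0 < a -> a <= b -> b - a <= D -> 0 < g -> g <= 1 ->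
  (a ^+ m)^-1 <= (b ^+ m)^-1 + m%:R * D `^ g * a `^ (- (m%:R + g)).
Proof.
move=> a0 ab bD g0 g1; have b0 : 0 < b by exact: lt_le_trans ab.
pose t := 1 - a / b.
have tE : t = (b - a) / b by rewrite /t mulrBl divff// gt_eqF.
have t0 : 0 <= t by rewrite tE; apply: divr_ge0; [rewrite subr_ge0|exact: ltW].
have t1 : t <= 1 by rewrite /t gerBl; apply: divr_ge0; exact: ltW.
have am0 : 0 < (a ^+ m)^-1 by rewrite invr_gt0 exprn_gt0.
have h1 : 1 - m%:R * t <= (a / b) ^+ m.
  have -> : a / b = 1 - t by rewrite /t subKr.
  exact: bernoulli_le.
have h2 : t <= D `^ g * a `^ (- g).
  have [->|tn0] := eqVneq t 0; first by rewrite mulr_ge0 ?powR_ge0.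
  have tp : 0 < t by rewrite lt_neqAle eq_sym tn0.
  apply: (@le_trans _ _ (t `^ g)); first by apply: ger1_powR; rewrite ?tp.
  rewrite tE powRM ?subr_ge0 ?invr_ge0 ?(ltW b0)//.
  apply: ler_pM; rewrite ?powR_ge0//.
    apply: ge0_ler_powR; rewrite ?nnegrE ?subr_ge0 ?(ltW g0)//.
    by apply: le_trans bD; rewrite subr_ge0.
  rewrite -powR_inv1 ?(ltW b0)// -powRrM mulN1r.
  by apply: le_powRN => //; exact: ltW.
have -> : a `^ (- (m%:R + g)) = (a ^+ m)^-1 * a `^ (- g).
  by rewrite opprD (powRD_gt0 _ a _ _ a0) (powRN a m%:R) powR_mulrn// ltW.
have -> : (b ^+ m)^-1 = (a ^+ m)^-1 * (a / b) ^+ m.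
  by rewrite exprMn exprVn mulKf// expf_neq0// gt_eqF.
have := ler_wpM2l (ltW am0) h1.
have := ler_wpM2l (ltW am0) (ler_wpM2l (ler0n R m) h2).
set X := D `^ g * a `^ (- g); set Y := (a / b) ^+ m; set Z := (a ^+ m)^-1.
have -> : m%:R * D `^ g * (Z * a `^ (- g)) = Z * (m%:R * X) by rewrite /X; ring.
lra.
Qed.

Lemma cvg_powR_gt0 (v : nat -> R) (l p : R) : (forall j, 0 < v j) -> 0 < l ->
  v @ \oo --> l -> (fun j => v j `^ p) @ \oo --> l `^ p.
Proof.
move=> v0 l0 vl.
rewrite (_ : (fun j => _) = fun j => expR (p * ln (v j))); last first.
  by apply/funext => j; rewrite /powR gt_eqF.
rewrite /powR gt_eqF//; apply: continuous_cvg; first exact: continuous_expR.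
apply: cvgM; first exact: cvg_cst.
by apply: continuous_cvg => //; exact: continuous_ln.
Qed.

(** The factor [c] may be +oo, the value of the kernels at their singularity, where multiplication
    is discontinuous. Monotonicity settles this case: the products are all 0 or eventually +oo. *)
Lemma cvge_nd_mulr (a : nat -> \bar R) (l c : \bar R) : (forall j, 0 <= a j)%E ->
  nondecreasing_seq a -> a @ \oo --> l -> (0 <= c)%E ->
  (fun j => a j * c)%E @ \oo --> (l * c)%E.
Proof.
move=> a0 nda al c0; case: c c0 => [c|_|//] c0; first exact: cvgeZr.
have le_l j : (a j <= l)%E.
  have <- : ereal_sup (range a) = l.
    by have := ereal_nondecreasing_cvgn nda; move/(cvg_unique _ al) => ->.
  by apply: ereal_sup_ubound; exists j.
have [l0|l0] := eqVneq l 0%E.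
  rewrite l0 mul0e; rewrite (_ : (fun j => _) = cst 0%E); first exact: cvg_cst.
  apply/funext => j; suff -> : a j = 0%E by rewrite mul0e.
  by apply/eqP; rewrite eq_le a0 -l0 le_l.
have lgt : (0 < l)%E by rewrite lt_neqAle eq_sym l0 (le_trans (a0 0%N)).
rewrite gt0_muley//; apply: cvg_near_cst.
have [j0 aj0] : exists j, (0 < a j)%E.
  apply: contrapT => /forallNP h; move/eqP: l0; apply.
  have -> : l = limn a by apply/esym/cvg_lim.
  rewrite (_ : a = cst 0%E) ?lim_cst//; apply/funext => j.
  by apply/eqP; rewrite eq_le a0 andbT leNgt; apply/negP; exact: h.
exists j0 => // j /= jj; apply: gt0_muley; exact: lt_le_trans (nda _ _ jj).
Qed.

End RealInequalities.

Section BoundaryPotential.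
Context {R : realType} (N : nat).
Variable mu : {measure set (pt R N) -> \bar R}.
Hypothesis N3 : (3 <= N)%N.
Hypothesis muf : locally_finite mu.
Hypothesis Ufin : forall x, (Upot mu x < +oo)%E.
Hypothesis supp : forall x, in_support mu x -> 0 < x.2.
Local Notation n := (N.-1).
Local Notation G := (Gpot N mu).

Lemma measurable_Gpot : measurable_fun setT G.
Proof.
apply: (measurableT_comp (@fine_measurable R setT measurableT)).
apply: (measurable_integral_param N mu muf _ _ _ (fun z => Green z.1 z.2)).
- exact: measurable_halfspace.
- exact: measurable_Green.
- by move=> z; exact: Green_ge0.
Qed.

Lemma Gpot_continuous_boundary (a : n.-tuple R) e : 0 < e ->
  exists2 d, 0 < d & forall z : pt R N, pdist z (a, 0) < d -> `|G z - G (a, 0)| < e.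
Proof.
move=> e0; have [r r0 mur] := null_pball N mu supp ((a, 0) : pt R N) (lexx _).
set m := (N - 2)%N; have m0 : 0 < m%:R :> R by rewrite ltr0n subn_gt0.
set f := G (a, 0); have f0 : 0 <= f by exact: Gpot_ge0.
(* The first bound gives m th <= 1/2, hence G z <= 2 f; the second keeps the error 2 m th f below
   e. *)
pose th := Num.min (2 * m%:R)^-1 (e / (2 * m%:R * (f + 1))).
have m20 : 0 < 2 * m%:R :> R by rewrite mulr_gt0.
have q0 : 0 < 2 * m%:R * (f + 1) by rewrite mulr_gt0//; lra.
have th0 : 0 < th by rewrite lt_min invr_gt0 m20 divr_gt0.
have th1 : m%:R * th <= 2^-1.
  have : th <= (2 * m%:R)^-1 by rewrite ge_min lexx.
  move/(ler_wpM2l (ltW m0)); suff -> : m%:R * (2 * m%:R)^-1 = 2^-1 :> R by [].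
  by field; rewrite gt_eqF.
have th2 : th * (2 * m%:R * (f + 1)) <= e.
  by rewrite -ler_pdivlMr// ge_min lexx orbT.
have thlt1 : th < 1.
  have m1 : 1 <= m%:R :> R by rewrite ler1n -(ltr0n R).
  nra.
exists (th * r) => [|z zd]; first exact: mulr_gt0.
have [l1 l2] := Gpot_near N mu N3 Ufin a r th z r0 mur (ltW th0) thlt1 (ltW zd).
rewrite -/f -/m in l1 l2.
have b1 := bernoulli_le th m (ltW th0) (ltW thlt1).
(* Multiplied by (1 - th)^m, the upper bound of f becomes (1 - th)^m f <= G z, so a single Bernoulli
   estimate serves both directions. *)
have q2 : (1 - th) ^+ m * (1 + th) ^+ m <= 1.
  rewrite -exprMn; apply: exprn_ile1; nra.
have Gz0 : 0 <= G z by exact: Gpot_ge0.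
set Q := (1 - th) ^+ m in l1 b1 q2.
set P := (1 + th) ^+ m in l2 q2.
have Q0 : 0 <= Q by rewrite exprn_ge0// subr_ge0 ltW.
have Qf : Q * f <= G z.
  apply: (@le_trans _ _ (Q * (P * G z))); first exact: ler_wpM2l.
  by rewrite mulrA; exact: (ler_piMl Gz0 q2).
have Mf : m%:R * th * f <= e / 2 - m%:R * th by nra.
rewrite ltr_norml; apply/andP; split; first by nra.
have : (1 - m%:R * th) * G z <= f by apply: le_trans l1; exact: ler_wpM2r.
nra.
Qed.

(** The assumed decay is used at a good point [z] in the null ball, within 1/2 of the boundary
    point, and brought back by [Upot_near] at the cost 2^m. The other factor 2 comes from the two
    terms of the Green function, which agree on the boundary. *)
Lemma Gpot_boundary_decay s : 0 <= s ->
  (exists C : R, 0 < C /\ ae_RN (fun x : pt R N =>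
     (Upot mu x <= (C * (1 + pnorm x) `^ (- s))%:E)%E)) ->
  exists2 C : R, 0 < C & forall a : n.-tuple R, G (a, 0) <= C * (1 + tnorm _ a) `^ (- s).
Proof.
move=> s0 [C [C0 ae]]; set m := (N - 2)%N.
exists (2 * 2 ^+ m * (C * 2^-1 `^ (- s))).
  by rewrite !mulr_gt0 ?exprn_gt0 ?powR_gt0// invr_gt0.
move=> a; have [r r0 mur] := null_pball N mu supp ((a, 0) : pt R N) (lexx _).
pose dd := Num.min r 2^-1; have dd0 : 0 < dd by rewrite lt_min r0 invr_gt0/=.
have dd1 : dd <= 2^-1 by rewrite ge_min lexx orbT.
have ddr : dd <= r by rewrite ge_min lexx.
pose l := dd / (n.+2)%:R.
have l0 : 0 < l by rewrite divr_gt0// ltr0n.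
have [z [zc /andP[z2 z2'] nz]] := nullRN_cube N (tnth a) 0 l _ l0 ae.
have Uz : (Upot mu z <= (C * (1 + pnorm z) `^ (- s))%:E)%E by apply: contrapT => h; apply: nz.
have zx : pdist z (a, 0) < dd.
  apply: le_lt_trans (pdist_le _ _ _) _; rewrite /= subr0 (ger0_norm z2).
  apply: (@le_lt_trans _ _ (n%:R * l + l)).
    apply: lerD; last by rewrite add0r in z2'.
    apply: tdist_le => [|i]; first exact: ltW.
    by have := zc i => /andP[h1 h2]; rewrite ger0_norm ?subr_ge0// lerBlDl.
  have -> : n%:R * l + l = n.+1%:R * l by rewrite -[n.+1]addn1 natrD mulrDl mul1r.
  by rewrite /l mulrCA gtr_pMr// ltr_pdivrMr ?ltr0n// mul1r ltr_nat.
have Ux := Upot_near N mu N3 _ _ _ r0 mur (lt_le_trans zx ddr).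
rewrite -lee_fin -(GpotE N mu N3 Ufin (a, 0)); apply: le_trans (Green_integral_le N mu N3 _) _.
rewrite reflect_boundary.
have t0 := tnorm_ge0 _ a; have zn := pnorm_ge0 _ z.
have key : (Upot mu (a, 0%R) <= (2 ^+ m * (C * 2^-1 `^ (- s) * (1 + tnorm _ a) `^ (- s)))%:E)%E.
  apply: le_trans Ux _; rewrite [leRHS]EFinM; apply: lee_wpmul2l.
    by rewrite lee_fin exprn_ge0.
  apply: le_trans Uz _; rewrite lee_fin -mulrA; apply: ler_wpM2l; first exact: ltW.
  rewrite -powRM ?invr_ge0//; last by lra.
  apply: le_powRN => //; first by rewrite mulr_gt0 ?invr_gt0//; lra.
  have := pdist_triangle _ (a, 0) z (origin _, 0).
  rewrite (pdistC _ (a, 0) z) -!pnormE pnorm_boundary; lra.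
apply: le_trans (leeD key key) _; rewrite -EFinD lee_fin le_eqVlt.
by apply/orP; left; apply/eqP; ring.
Qed.

End BoundaryPotential.

(** * Existence *)

Section BoundaryOperator.
Context {R : realType} (N : nat).
Variables (k p : R).
Local Notation n := (N.-1).
Hypothesis N3 : (3 <= N)%N.
Hypothesis k1 : 1 < k.
Hypothesis kn : k < n%:R.
Hypothesis p0 : 0 < p.

Definition Wpot (h : n.-tuple R -> \bar R) (x : pt R N) : \bar R :=
  tint (fun y => (h y * kerN x y)%E).

Lemma Hu_ge0 v y : (0 <= @Hu R N k p v y)%E.
Proof. by apply: tint_ge0 => z; rewrite mule_ge0 ?lee_fin ?powR_ge0 ?kerk_ge0. Qed.

Lemma Wpot_ge0 h x : (forall y, 0 <= h y)%E -> (0 <= Wpot h x)%E.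
Proof. by move=> h0; apply: tint_ge0 => z; rewrite mule_ge0// kerN_ge0. Qed.

Lemma le_Hu (v w : n.-tuple R -> R) y : (forall z, 0 <= v z <= w z) ->
  (Hu k p v y <= Hu k p w y)%E.
Proof.
move=> vw; apply: le_tint => z; first by rewrite mule_ge0 ?lee_fin ?powR_ge0 ?kerk_ge0.
apply: lee_wpmul2r; first exact: kerk_ge0.
have /andP[v0 vwz] := vw z; rewrite lee_fin.
by apply: ge0_ler_powR; rewrite ?nnegrE ?(ltW p0)//; exact: le_trans vwz.
Qed.

Lemma le_Wpot h g x : (forall y, 0 <= h y <= g y)%E -> (Wpot h x <= Wpot g x)%E.
Proof.
move=> hg; apply: le_tint => z; have /andP[h0 hgz] := hg z.
  by rewrite mule_ge0// kerN_ge0.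
by apply: lee_wpmul2r => //; exact: kerN_ge0.
Qed.

Lemma measurable_Hu_integrand (v : n.-tuple R -> R) y : measurable_fun setT v ->
  measurable_fun setT (fun z => ((v z `^ p)%:E * kerk k y z)%E).
Proof.
move=> mv; apply: emeasurable_funM; last by apply: measurable_kerk => //; exact: measurable_cst.
by apply/measurable_EFinP; exact: (measurableT_comp (measurable_powR p) mv).
Qed.

Lemma measurable_Hu (v : n.-tuple R -> R) : measurable_fun setT v ->
  measurable_fun setT (@Hu R N k p v).
Proof.
move=> mv; apply: (measurable_tint _ _ _
  (fun z : n.-tuple R * n.-tuple R => ((v z.2 `^ p)%:E * kerk k z.1 z.2)%E)).
- apply: emeasurable_funM; last exact: measurable_kerk.
  have m1 := measurableT_comp (measurable_powR p) mv.
  by apply/measurable_EFinP; exact: (measurableT_comp m1 measurable_snd).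
- by move=> z; rewrite mule_ge0 ?lee_fin ?powR_ge0 ?kerk_ge0.
Qed.

Lemma measurable_Wpot_integrand h (x : pt R N) :
  measurable_fun setT h ->
  measurable_fun setT (fun y => (h y * kerN x y)%E).
Proof.
move=> mh; apply: emeasurable_funM => //.
by apply: measurable_kerN => //; exact: measurable_cst.
Qed.

Lemma measurable_Wpot h : measurable_fun setT h -> (forall y, 0 <= h y)%E ->
  measurable_fun setT (Wpot h).
Proof.
move=> mh h0; apply: (measurable_tint _ _ _
  (fun z : pt R N * n.-tuple R => (h z.2 * kerN z.1 z.2)%E)).
- apply: emeasurable_funM; last exact: measurable_kerN.
  exact: (measurableT_comp mh measurable_snd).
- by move=> z; rewrite mule_ge0// kerN_ge0.
Qed.

Let n0 : (0 < n)%N. Proof. by case: N N3 => [|[|]]. Qed.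
Let nE : n = (N - 2).+1. Proof. by case: N N3 => [|[|[|m]]]. Qed.
Let nR : n%:R = (N - 2)%:R + 1 :> R. Proof. by rewrite nE -natr1. Qed.
Let m1 : 1 <= (N - 2)%:R :> R. Proof. by rewrite ler1n subn_gt0. Qed.
Let k0 : 0 < k. Proof. exact: lt_trans k1. Qed.

Lemma measurable_decay b : measurable_fun setT (fun y : n.-tuple R => ((1 + tnorm _ y) `^ b)%:E).
Proof.
apply/measurable_EFinP; apply: (measurableT_comp (measurable_powR b)).
apply: measurable_funD; first exact: measurable_cst.
by apply: measurable_tdist => //; exact: measurable_cst.
Qed.

(** Kernel decay with a = m = k and b = p s, whose condition at infinity is n < p s. *)
Lemma Hu_decay (s : R) : 0 < s -> n%:R < p * s -> exists2 A : R, 0 < A &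
  forall M (v : n.-tuple R -> R), 0 <= M ->
    (forall z, 0 <= v z <= M * (1 + tnorm _ z) `^ (- s)) ->
    forall y, (Hu k p v y <= (A * M `^ p * (1 + tnorm _ y) `^ (- k))%:E)%E.
Proof.
move=> s0 ps.
have kn' := kn; have k1' := k1; have k0' := k0; have nR' := nR; have m1' := m1.
have [||||||A A0 HA] := @tint_kernel_decay R N n0 k (p * s) k => //; try lra.
exists A => // M v M0 hv y.
apply: (@le_trans _ _ (tint (fun z => (M `^ p)%:E *
    (((1 + tnorm _ z) `^ (- (p * s)))%:E * kerk k y z))%E)).
  apply: le_tint => z; first by rewrite mule_ge0 ?lee_fin ?powR_ge0 ?kerk_ge0.
  rewrite muleA -EFinM; apply: lee_wpmul2r; first exact: kerk_ge0.
  have /andP[v0 vM] := hv z.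
  have -> : - (p * s) = - s * p by ring.
  rewrite lee_fin powRrM -powRM ?powR_ge0//.
  by apply: ge0_ler_powR; rewrite ?nnegrE ?(ltW p0) ?mulr_ge0 ?powR_ge0.
rewrite tintZl; last 3 first.
- apply: emeasurable_funM; first exact: measurable_decay.
  by apply: measurable_kerk => //; exact: measurable_cst.
- by move=> z; rewrite mule_ge0 ?lee_fin ?powR_ge0 ?kerk_ge0.
- by rewrite lee_fin powR_ge0.
rewrite (mulrC A) -mulrA EFinM; apply: lee_wpmul2l; last exact: HA.
by rewrite lee_fin powR_ge0.
Qed.

Lemma tint_decay_kerk a h (A : R) x b :
  (forall y, 0 <= h y <= (A * (1 + tnorm _ y) `^ (- k))%:E)%E ->
  0 <= A ->
  (tint (fun y => ((1 + tnorm _ y) `^ (- k))%:E * @kerk R N a x y)%E <= b)%E ->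
  (tint (fun y => h y * @kerk R N a x y) <= A%:E * b)%E.
Proof.
move=> hA A0 hb.
apply: (@le_trans _ _ (tint (fun y => A%:E *
    (((1 + tnorm _ y) `^ (- k))%:E * @kerk R N a x y))%E)).
  apply: le_tint => y; have /andP[h0 hy] := hA y; first by rewrite mule_ge0// kerk_ge0.
  by rewrite muleA -EFinM; apply: lee_wpmul2r => //; exact: kerk_ge0.
rewrite tintZl; last 3 first.
- apply: emeasurable_funM; first exact: measurable_decay.
  by apply: measurable_kerk => //; exact: measurable_cst.
- by move=> z; rewrite mule_ge0 ?lee_fin ?powR_ge0 ?kerk_ge0.
- by rewrite lee_fin.
by apply: lee_wpmul2l => //; rewrite lee_fin.
Qed.

(** Kernel decay with a = N - 2 = n - 1, b = k and m = s, whose condition at infinity is s < k -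
    1. *)
Lemma Wpot_decay (s : R) : 0 <= s -> s < k - 1 -> exists2 C : R, 0 < C &
  forall A h, 0 <= A -> (forall y, 0 <= h y <= (A * (1 + tnorm _ y) `^ (- k))%:E)%E ->
  forall x, (Wpot h x <= (C * A * (1 + tnorm _ x.1) `^ (- s))%:E)%E.
Proof.
move=> s0 sk.
have kn' := kn; have k1' := k1; have k0' := k0; have nR' := nR; have m1' := m1.
have [||||||C C0 HC] := @tint_kernel_decay R N n0 (N - 2)%:R k s => //; try lra.
exists C => // A h A0 hA x.
apply: (@le_trans _ _ (tint (fun y => h y * @kerk R N (N - 2)%:R x.1 y)%E)).
  apply: le_tint => y; have /andP[h0 hy] := hA y; first by rewrite mule_ge0// kerN_ge0.
  by apply: lee_wpmul2l => //; exact: kerN_le.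
apply: le_trans (tint_decay_kerk _ _ A _ _ hA A0 (HC x.1)) _.
by rewrite -EFinM lee_fin le_eqVlt; apply/orP; left; apply/eqP; ring.
Qed.

(** Hölder continuity of order [g] is paid for by a singularity of exponent N - 2 + g, still below n
    when g < 1. If [x] is the farther of the two points from [(y, 0)], its kernel is already the
    smaller one. *)
Lemma kerN_holder (x z : pt R N) (g : R) y : 0 < g -> g <= 1 ->
  (kerN x y <= kerN z y +
    ((N - 2)%:R * pdist x z `^ g)%:E * @kerk R N ((N - 2)%:R + g) x.1 y)%E.
Proof.
move=> g0 g1; have [->|xz] := eqVneq x z.
  by rewrite leeDl// mule_ge0 ?kerk_ge0// lee_fin mulr_ge0 ?powR_ge0.
have D0 := pdist_gt0 _ _ _ xz.
have c0 : 0 < (N - 2)%:R * pdist x z `^ g.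
  by apply: mulr_gt0; [exact: lt_le_trans m1|exact: powR_gt0].
have [xy|xy] := eqVneq x.1 y.
  rewrite /kerk xy eqxx gt0_muley ?lte_fin// addey ?leey//.
  by rewrite gt_eqF// (lt_le_trans _ (kerN_ge0 _ _ _)).
have [zy|zy] := eqVneq z (y, 0).
  have -> : kerN z y = +oo%E by rewrite /kerN zy eqxx.
  rewrite addye ?leey// -ltNye (lt_le_trans (ltNyr 0))//; apply: mule_ge0.
    by rewrite lee_fin ltW.
  exact: kerk_ge0.
have xy' : x != (y, 0) by apply: contra xy => /eqP ->.
rewrite /kerN /kerk (negbTE zy) (negbTE xy') (negbTE xy) -EFinM -EFinD lee_fin -powRN.
have t0 := tdist_gt0 _ _ _ xy; have x0 := pdist_gt0 _ _ _ xy'; have z0 := pdist_gt0 _ _ _ zy.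
have q0 : 0 <= (N - 2)%:R * pdist x z `^ g * tdist x.1 y `^ (- ((N - 2)%:R + g)).
  by apply: mulr_ge0; [exact: ltW|exact: powR_ge0].
have [ab|ba] := leP (pdist x (y, 0)) (pdist z (y, 0)).
  have bD : pdist z (y, 0) - pdist x (y, 0) <= pdist x z.
    by have := pdist_triangle _ z x (y, 0); rewrite (pdistC _ z x); lra.
  apply: le_trans (inv_pow_holder _ _ _ g (N - 2) x0 ab bD g0 g1) _.
  rewrite lerD2l; apply: ler_wpM2l; first exact: ltW.
  apply: le_powRN => //; first exact: (le_tdist_pdist _ x (y, 0)).
  by apply: addr_ge0 => //; exact: ltW.
apply: ler_wpDr => //; rewrite lef_pV2 ?posrE ?exprn_gt0//.
by apply: lerXn2r; rewrite ?nnegrE; exact: ltW.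
Qed.

Lemma Wpot_holder : exists2 C : R, 0 < C &
  forall A h, 0 <= A -> measurable_fun setT h ->
  (forall y, 0 <= h y <= (A * (1 + tnorm _ y) `^ (- k))%:E)%E ->
  forall x z, (Wpot h x <= Wpot h z + (C * A * pdist x z `^ (2^-1))%:E)%E.
Proof.
have kn' := kn; have k1' := k1; have k0' := k0; have nR' := nR; have m1' := m1.
(* The order 1/2 is a choice in (0, 1); taking m = 0 gives a bound uniform in [x], and k > 1 ensures
   the condition at infinity. *)
have [||||||C C0 HC] := @tint_kernel_decay R N n0 ((N - 2)%:R + 2^-1) k 0 => //; try lra.
exists ((N - 2)%:R * C); first by apply: mulr_gt0 => //; exact: lt_le_trans m1.
move=> A h A0 mh hA x z.
set c := ((N - 2)%:R * pdist x z `^ (2^-1)).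
have c0 : 0 <= c by rewrite mulr_ge0 ?powR_ge0.
have h0 y : (0 <= h y)%E by case/andP: (hA y).
apply: (@le_trans _ _ (tint (fun y => h y * kerN z y +
    c%:E * (h y * @kerk R N ((N - 2)%:R + 2^-1) x.1 y))%E)).
  apply: le_tint => y; first by rewrite mule_ge0// kerN_ge0.
  rewrite muleCA -ge0_muleDr; last 2 first.
  - exact: kerN_ge0.
  - by rewrite mule_ge0 ?kerk_ge0// lee_fin.
  by apply: lee_wpmul2l => //; apply: kerN_holder; lra.
have mk : measurable_fun setT (fun y => h y * @kerk R N ((N - 2)%:R + 2^-1) x.1 y)%E.
  apply: emeasurable_funM => //.
  by apply: measurable_kerk => //; exact: measurable_cst.
have k_ge0 y : (0 <= h y * @kerk R N ((N - 2)%:R + 2^-1) x.1 y)%E.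
  by rewrite mule_ge0// kerk_ge0.
rewrite tintD; last 4 first.
- exact: measurable_Wpot_integrand.
- by move=> y; rewrite mule_ge0// kerN_ge0.
- exact: measurable_funeM.
- by move=> y; rewrite mule_ge0// lee_fin.
rewrite tintZl//; apply: leeD => //.
apply: (@le_trans _ _ (c%:E * (A%:E * C%:E))%E).
  apply: lee_wpmul2l; first by rewrite lee_fin.
  apply: tint_decay_kerk => //.
  by have := HC x.1; rewrite oppr0 powRr0 mulr1.
by rewrite -!EFinM lee_fin /c le_eqVlt; apply/orP; left; apply/eqP; ring.
Qed.

End BoundaryOperator.

(** * Picard iteration below a supersolution *)

Section FixedPoint.
Context {R : realType} (N : nat).
Variables (k p : R).
Local Notation n := (N.-1).
Hypothesis N3 : (3 <= N)%N.
Hypothesis p0 : 0 < p.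
Variables (f b : n.-tuple R -> R) (g : R).
Hypothesis mf : measurable_fun setT f.
Hypothesis f0 : forall a, 0 < f a.
Hypothesis fb : forall a, f a <= b a.
Hypothesis g0 : 0 <= g.
Local Notation W v := (Wpot N (Hu k p v)).

(* The a priori bound making [b] a supersolution. *)
Hypothesis Wb : forall v : n.-tuple R -> R, (forall z, 0 <= v z <= b z) ->
  forall a, (W v (a, 0%R) < +oo)%E /\ f a + g * fine (W v (a, 0%R)) <= b a.

(** On functions between 0 and [b] the potential is finite by [Wb], so [fine] loses nothing
    there. *)
Definition picard (v : n.-tuple R -> R) (a : n.-tuple R) : R :=
  f a + g * fine (W v (a, 0)).

Lemma Wfin (v : n.-tuple R -> R) a : (forall z, 0 <= v z <= b z) ->
  W v (a, 0) = (fine (W v (a, 0)))%:E.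
Proof.
move=> vb; rewrite fineK// ge0_fin_numE; first by have [] := Wb v vb a.
by apply: Wpot_ge0 => y; exact: Hu_ge0.
Qed.

Let v j := iter j picard f.

Lemma iter_picard_bounds j a : f a <= v j a <= b a.
Proof.
elim: j a => [|j IH] a; first by rewrite /v/= lexx fb.
have vb z : 0 <= v j z <= b z.
  by have /andP[h1 ->] := IH z; rewrite andbT (le_trans _ h1)// ltW.
rewrite /v iterS -/(v j) /picard; apply/andP; split; last by have [] := Wb _ vb a.
by rewrite lerDl mulr_ge0// fine_ge0// Wpot_ge0// => y; exact: Hu_ge0.
Qed.

Lemma iter_picard_ge0 j a : 0 <= v j a <= b a.
Proof.
by have /andP[h1 ->] := iter_picard_bounds j a; rewrite andbT (le_trans _ h1)// ltW.
Qed.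

Lemma iter_picard_gt0 j a : 0 < v j a.
Proof. by have /andP[h1 _] := iter_picard_bounds j a; exact: lt_le_trans h1. Qed.

(** The operator is monotone and its value at the start [f] lies above [f]. *)
Lemma iter_picard_nd a : nondecreasing_seq (v ^~ a).
Proof.
apply/nondecreasing_seqP => j; elim: j a => [|j IH] a.
  by have /andP[] := iter_picard_bounds 1 a.
have vS i : v i.+1 = picard (v i) by [].
rewrite (vS j.+1) (vS j) lerD2l; apply: (ler_wpM2l g0).
apply: fine_le.
- by rewrite (Wfin (v j) a (iter_picard_ge0 j)).
- by rewrite (Wfin (v j.+1) a (iter_picard_ge0 j.+1)).
apply: le_Wpot => y; rewrite Hu_ge0/=; apply: le_Hu => // z.
by have /andP[-> _] := iter_picard_ge0 j z; exact: IH.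
Qed.

Lemma measurable_iter_picard j : measurable_fun setT (v j).
Proof.
elim: j => [//|j IH]; rewrite /v iterS -/(v j).
apply: measurable_funD => //; apply: measurable_funM; first exact: measurable_cst.
have mW : measurable_fun setT (W (v j)).
  by apply: measurable_Wpot => [|y]; [exact: measurable_Hu|exact: Hu_ge0].
have mW0 := measurableT_comp mW (measurable_pair0 N _ _ _ (@measurable_id _ (n.-tuple R) setT)).
exact: (measurableT_comp (@fine_measurable R setT measurableT) mW0).
Qed.

Definition picard_limit (a : n.-tuple R) : R := limn (v ^~ a).
Local Notation vv := picard_limit.

Lemma cvg_picard a : v ^~ a @ \oo --> vv a.
Proof.
apply: nondecreasing_is_cvgn; first exact: iter_picard_nd.
by exists (b a) => _ [j _ <-]; have /andP[] := iter_picard_bounds j a.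
Qed.

Lemma picard_limit_ge j a : v j a <= vv a.
Proof.
apply: nondecreasing_cvgn_le; first exact: iter_picard_nd.
by apply/cvg_ex; exists (vv a); exact: cvg_picard.
Qed.

Lemma picard_limit_gt0 a : 0 < vv a.
Proof. exact: lt_le_trans (f0 a) (picard_limit_ge 0 a). Qed.

Lemma picard_limit_bounds a : 0 <= vv a <= b a.
Proof.
rewrite (ltW (picard_limit_gt0 a))/=; apply: limr_le.
  by apply/cvg_ex; exists (vv a); exact: cvg_picard.
by apply: nearW => j; have /andP[] := iter_picard_bounds j a.
Qed.

Lemma measurable_picard_limit : measurable_fun setT vv.
Proof.
apply: (measurable_fun_cvg measurable_iter_picard) => x _; exact: cvg_picard.
Qed.

Lemma nd_Hu_picard y : nondecreasing_seq (fun j => Hu k p (v j) y).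
Proof.
move=> i j ij; apply: le_Hu => // z; have /andP[-> _] := iter_picard_ge0 i z.
exact: iter_picard_nd.
Qed.

(** Positivity of the iterates and of the limit lets the power p pass to the limit as exp (p ln v);
    at z = y, where the kernel is infinite, [cvge_nd_mulr] takes over. *)
Lemma cvg_Hu_picard y : (fun j => Hu k p (v j) y) @ \oo --> Hu k p vv y.
Proof.
apply: cvg_tint_monotone.
- by move=> j; apply: measurable_Hu_integrand; exact: measurable_iter_picard.
- by move=> j z; rewrite mule_ge0 ?lee_fin ?powR_ge0 ?kerk_ge0.
- move=> z i j ij; apply: lee_wpmul2r; first exact: kerk_ge0.
  rewrite lee_fin; apply: ge0_ler_powR; rewrite ?nnegrE ?(ltW p0)//.
  + exact: ltW (iter_picard_gt0 _ _).
  + exact: ltW (iter_picard_gt0 _ _).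
  + exact: iter_picard_nd.
- move=> z; apply: cvge_nd_mulr; last exact: kerk_ge0.
  + by move=> j; rewrite lee_fin powR_ge0.
  + move=> i j ij; rewrite lee_fin; apply: ge0_ler_powR; rewrite ?nnegrE ?(ltW p0)//.
    * exact: ltW (iter_picard_gt0 _ _).
    * exact: ltW (iter_picard_gt0 _ _).
    * exact: iter_picard_nd.
  + apply: cvg_EFin; first exact: nearW.
    apply: cvg_powR_gt0; last exact: cvg_picard.
      by move=> j; exact: iter_picard_gt0.
    exact: picard_limit_gt0.
Qed.

Lemma cvg_Wpot_picard x : (fun j => W (v j) x) @ \oo --> W vv x.
Proof.
apply: cvg_tint_monotone.
- move=> j; apply: measurable_Wpot_integrand; apply: measurable_Hu.
  exact: measurable_iter_picard.
- by move=> j y; rewrite mule_ge0 ?Hu_ge0 ?kerN_ge0.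
- move=> y i j ij; apply: lee_wpmul2r; first exact: kerN_ge0.
  exact: nd_Hu_picard.
- move=> y; apply: cvge_nd_mulr; last exact: kerN_ge0.
  + by move=> j; exact: Hu_ge0.
  + exact: nd_Hu_picard.
  + exact: cvg_Hu_picard.
Qed.

Lemma picard_limit_fixed a : vv a = f a + g * fine (W vv (a, 0)).
Proof.
have c1 : (fun j => v j.+1 a) @ \oo --> vv a.
  by have := cvg_picard a; rewrite -(cvg_shiftS (v ^~ a)).
have c2 : (fun j => v j.+1 a) @ \oo --> f a + g * fine (W vv (a, 0)).
  rewrite (_ : (fun j => _) = fun j => f a + g * fine (W (v j) (a, 0))); last first.
    by apply/funext => j; rewrite /v iterS.
  apply: cvgD; first exact: cvg_cst.
  apply: cvgM; first exact: cvg_cst.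
  apply: fine_cvg; rewrite -Wfin; last exact: picard_limit_bounds.
  exact: cvg_Wpot_picard.
exact: (cvg_unique _ c1 c2).
Qed.

End FixedPoint.

(** * Construction of the solution for small lambda *)

Section Existence.
Context {R : realType} (N : nat).
Local Notation n := (N.-1).

Lemma nullRN_empty (A : set (pt R N)) : (forall x, ~ A x) -> nullRN A.
Proof.
move=> nA; exists set0; split => //; split => [x /nA//|].
rewrite -[RHS](@tint0 R n); apply: eq_tint => t.
by under eq_integral do rewrite indicE in_set0; exact: integral0.
Qed.

Lemma nullRn_empty m (A : set (m.-tuple R)) : (forall x, ~ A x) -> nullRn A.
Proof.
move=> nA; exists set0; split => //; split => [x /nA//|].
by case: (@null0 R m).
Qed.

Variable mu : {measure set (pt R N) -> \bar R}.
Variables (k p : R).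
Hypothesis N3 : (3 <= N)%N.
Hypothesis k1 : 1 < k.
Hypothesis kn : k < n%:R.
Hypothesis p0 : 0 < p.
Hypothesis pk : n%:R / (k - 1) < p.
Hypothesis mu0 : mu setT <> 0%E.
Hypothesis muf : locally_finite mu.
Hypothesis supp : forall x, in_support mu x -> 0 < x.2.
Hypothesis Ufin : forall x, (Upot mu x < +oo)%E.
Hypothesis Udecay : exists C : R, 0 < C /\
  ae_RN (fun x : pt R N => (Upot mu x <= (C * (1 + pnorm x) `^ (1 - k))%:E)%E).

Local Notation kap := (((N - 2)%:R * sigmaN R N)^-1).

Lemma small_lambda_solution : exists lstar : R, 0 < lstar /\
  forall lam : R, 0 < lam -> lam < lstar ->
    exists u ut, positive_solution k p lam mu u ut /\
      exists gam : R, 0 < gam /\ gam < 1 /\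
        exists w : pt R N -> R, holder_closed_half gam w /\
          forall x : pt R N, 0 < x.2 ->
            (u x)%:E = (\int[mu]_(y in @halfspace R N) Green x y + (w x)%:E)%E.
Proof.
have k1' := k1; have kn' := kn; have p0' := p0; have kap0 := kap_gt0 N N3 (R := R).
have s0 : 0 < k - 1 by rewrite subr_gt0.
have np : n%:R / p < k - 1 by rewrite ltr_pdivrMr// mulrC -ltr_pdivrMr.
have np0 : 0 <= n%:R / p by rewrite divr_ge0// ltW.
(* The midpoint of n/p and k - 1 satisfies both constraints on the exponent strictly. *)
have [sp spE] : {v : R | v = (k - 1 + n%:R / p) / 2} by eexists.
have sp1 : n%:R / p < sp by lra.
have sp2 : sp < k - 1 by lra.
have sp0 : 0 < sp by lra.
have psp : n%:R < p * sp by rewrite mulrC -ltr_pdivrMr.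
have [Cf Cf0 fdecay] : exists2 C : R, 0 < C & forall a : n.-tuple R,
    Gpot N mu (a, 0) <= C * (1 + tnorm _ a) `^ (- sp).
  have [|C C0 HC] := Gpot_boundary_decay N mu N3 Ufin supp (k - 1) (ltW s0).
    by rewrite opprB.
  exists C => // a; apply: le_trans (HC a) _; apply: ler_wpM2l; first exact: ltW.
  have t0 := tnorm_ge0 _ a; apply: ler_powR; first lra.
  by rewrite lerN2 ltW.
have [A A0 HA] := Hu_decay N k p N3 k1 kn p0 sp sp0 psp.
have [C2 C20 HC2] := Wpot_decay N k N3 k1 kn sp (ltW sp0) sp2.
have [C3 C30 HC3] := Wpot_holder N k N3 k1 kn.
(* One half of [M] is for the Green potential, the other for the integral term. *)
pose M := 2 * Cf.
have M0 : 0 < M by rewrite mulr_gt0.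
have [A' A'E] : {v : R | v = A * M `^ p} by eexists.
have A'0 : 0 < A' by rewrite A'E mulr_gt0// powR_gt0.
(* Below this value 2 lam kap C2 A' <= Cf, so the integral term stays within its half of [b]. *)
exists (Cf / (2 * kap * (C2 * A'))).
have den0 : 0 < 2 * kap * (C2 * A') by apply: mulr_gt0; apply: mulr_gt0.
split; first exact: divr_gt0.
move=> lam lam0 lamlt.
have [g gE] : {v : R | v = 2 * lam / ((N - 2)%:R * sigmaN R N)} by eexists.
have g0 : 0 < g by rewrite gE; apply: mulr_gt0 => //; exact: mulr_gt0.
have gsmall : g * (C2 * A') <= Cf.
  move: lamlt; rewrite ltr_pdivlMr// => /ltW; rewrite gE; apply: le_trans.
  by rewrite le_eqVlt; apply/orP; left; apply/eqP; ring.
pose f (a : n.-tuple R) := Gpot N mu (a, 0).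
pose b (a : n.-tuple R) := M * (1 + tnorm _ a) `^ (- sp).
have Hb (v : n.-tuple R -> R) : (forall z, 0 <= v z <= b z) -> forall y,
    (0 <= Hu k p v y <= (A' * (1 + tnorm _ y) `^ (- k))%:E)%E.
  by move=> vb y; rewrite Hu_ge0/= A'E; apply: HA => //; exact: ltW.
have Wle (v : n.-tuple R -> R) : (forall z, 0 <= v z <= b z) -> forall x,
    (Wpot N (Hu k p v) x <= (C2 * A' * (1 + tnorm _ x.1) `^ (- sp))%:E)%E.
  by move=> vb x; apply: HC2; [exact: ltW|exact: Hb].
have Wfin' (v : n.-tuple R -> R) : (forall z, 0 <= v z <= b z) -> forall x,
    Wpot N (Hu k p v) x = (fine (Wpot N (Hu k p v) x))%:E.
  move=> vb x; rewrite fineK// ge0_fin_numE; first exact: le_lt_trans (Wle v vb x) (ltry _).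
  by apply: Wpot_ge0 => y; exact: Hu_ge0.
have mf : measurable_fun setT f.
  have mG := measurable_Gpot N mu N3 muf.
  exact: (measurableT_comp mG (measurable_pair0 N _ _ _ (@measurable_id _ (n.-tuple R) setT))).
have Gpos x : 0 < Gpot N mu x.
  by rewrite -lte_fin -(GpotE N mu N3 Ufin); exact: Green_integral_gt0.
have fb a : f a <= b a.
  apply: le_trans (fdecay a) _; apply: ler_wpM2r; first exact: powR_ge0.
  by rewrite /M; lra.
have Wb (v : n.-tuple R -> R) : (forall z, 0 <= v z <= b z) -> forall a : n.-tuple R,
    (Wpot N (Hu k p v) (a, 0%R) < +oo)%E /\
    f a + g * fine (Wpot N (Hu k p v) (a, 0%R)) <= b a.
  move=> vb a; have := Wle v vb (a, 0); rewrite (Wfin' v vb) lee_fin/= => hW.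
  split; first exact: ltry.
  have P0 := powR_ge0 (1 + tnorm _ a) (- sp).
  have h1 := fdecay a.
  have h2 : g * fine (Wpot N (Hu k p v) (a, 0)) <= Cf * (1 + tnorm _ a) `^ (- sp).
    apply: (@le_trans _ _ (g * (C2 * A' * (1 + tnorm _ a) `^ (- sp)))).
      by apply: ler_wpM2l => //; exact: ltW.
    by rewrite mulrA; apply: ler_wpM2r.
  by rewrite /b /M /f; lra.
pose v := picard_limit N k p f g.
have vb z : 0 <= v z <= b z.
  exact: (picard_limit_bounds N k p p0 f b g (fun a => Gpos _) fb (ltW g0) Wb).
have mv : measurable_fun setT v.
  exact: (measurable_picard_limit N k p p0 f b g mf (fun a => Gpos _) fb (ltW g0) Wb).
have vE a : v a = f a + g * fine (Wpot N (Hu k p v) (a, 0)).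
  exact: (picard_limit_fixed N k p p0 f b g mf (fun a => Gpos _) fb (ltW g0) Wb).
pose w x := g * fine (Wpot N (Hu k p v) x).
pose u x := Gpot N mu x + w x.
have w0 x : 0 <= w x.
  by rewrite mulr_ge0 ?fine_ge0 ?(ltW g0)// Wpot_ge0// => y; exact: Hu_ge0.
(* A single constant for the sup bound, which uses C2, and the Hölder bound, which uses C3. *)
pose C := g * ((C2 + C3) * A').
have C0 : 0 < C by apply: mulr_gt0 => //; apply: mulr_gt0 => //; exact: addr_gt0.
have wle x : w x <= C.
  apply: (@le_trans _ _ (g * (C2 * A'))).
    apply: ler_wpM2l; first exact: ltW.
    have := Wle v vb x; rewrite (Wfin' v vb) lee_fin => /le_trans; apply.
    rewrite ler_piMr//; first by rewrite mulr_ge0 ?(ltW C20) ?(ltW A'0).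
    have t0 := tnorm_ge0 _ x.1.
    have e : 1 `^ (- sp) = 1 :> R by rewrite powR1.
    rewrite -[leRHS]e; apply: le_powRN => //; [lra|exact: ltW].
  by rewrite /C ler_pM2l// ler_pM2r// lerDl ltW.
have wh x z : w x - w z <= C * pdist x z `^ (2^-1).
  have d0 := powR_ge0 (pdist x z) 2^-1.
  have := HC3 A' (Hu k p v) (ltW A'0) (measurable_Hu N k p v mv) (Hb v vb) x z.
  rewrite (Wfin' v vb x) (Wfin' v vb z) -EFinD lee_fin => h.
  rewrite /w -mulrBr /C -mulrA; apply: ler_wpM2l; first exact: ltW.
  apply: (@le_trans _ _ (C3 * A' * pdist x z `^ 2^-1)); first by lra.
  by apply: ler_wpM2r => //; rewrite ler_pM2r// lerDr ltW.
have whn x z : `|w x - w z| <= C * pdist x z `^ (2^-1).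
  by rewrite ler_norml wh andbT lerNl opprB (pdistC _ x z) wh.
exists u, v; split; last first.
  exists 2^-1; split; first by lra.
  split; first by lra.
  exists w; split; last by move=> x _; rewrite (GpotE N mu N3 Ufin).
  exists C; split => [x _|x z _ _]; last exact: whn.
  by rewrite ger0_norm.
(* Each condition holds without exception on its domain, so all exceptional sets are empty. *)
split; [|split; [|split; [|split; [|split]]]].
- exists u; split; last by apply: nullRN_empty => x /= [_]; apply.
  apply: measurable_funD; first exact: measurable_Gpot.
  apply: measurable_funM; first exact: measurable_cst.
  apply: (measurableT_comp (@fine_measurable R setT measurableT)).
  by apply: measurable_Wpot => [|y]; [exact: measurable_Hu|exact: Hu_ge0].
- by apply: nullRN_empty => x /= [_]; apply; rewrite /u ltr_pwDl.
- apply: nullRn_empty => a /=; apply => e e0.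
  have [d1 d10 hd1] := Gpot_continuous_boundary N mu N3 Ufin supp a (e / 2)
    (divr_gt0 e0 (ltr0Sn _ _)).
  (* Within distance q^2 the Hölder bound of order 1/2 gives at most C q < e/2. *)
  pose q := e / (2 * (C + 1)).
  have q0 : 0 < q by rewrite divr_gt0// mulr_gt0//; lra.
  exists (Num.min d1 (q ^+ 2)); first by rewrite lt_min d10 exprn_gt0.
  move=> z z0; rewrite lt_min => /andP[zd1 zq].
  have hw : `|w z - w (a, 0)| <= C * q.
    apply: le_trans (whn z (a, 0)) _; apply: ler_wpM2l; first exact: ltW.
    rewrite powR12_sqrt ?pdist_ge0// -[leRHS](gtr0_norm q0) -sqrtr_sqr.
    by apply: ler_wsqrtr; exact: ltW.
  have Cq : C * q < e / 2.
    have -> : e / 2 = (C + 1) * q.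
      have c0 : C + 1 != 0 by rewrite gt_eqF// addr_gt0.
      by rewrite /q invfM mulrCA (mulrCA (C + 1)) divff// mulr1.
    by rewrite ltr_pM2r// ltrDl.
  have -> : u z - v a = (Gpot N mu z - Gpot N mu (a, 0)) + (w z - w (a, 0)).
    by rewrite /u vE opprD addrACA.
  apply: le_lt_trans (ler_normD _ _) _.
  have := hd1 z zd1; lra.
- apply: nullRn_empty => a /=; apply.
  by have /andP[_ h] := Hb v vb a; exact: le_lt_trans h (ltry _).
- apply: nullRN_empty => x /= [_]; apply.
  exact: le_lt_trans (Wle v vb x) (ltry _).
- apply: nullRN_empty => x /= [x0]; apply.
  rewrite (GpotE N mu N3 Ufin) -gE.
  (* In the definition of a solution the single layer kernel stands under the inner integral; being
     constant in [z], it is taken out. *)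
  rewrite (_ : tint _ = Wpot N (Hu k p v) x).
    by rewrite (Wfin' v vb) -EFinM -EFinD.
  apply: eq_tint => y; rewrite muleC /Hu -tintZl.
  + by apply: eq_tint => z; rewrite muleCA muleA.
  + exact: measurable_Hu_integrand.
  + by move=> z; rewrite mule_ge0 ?lee_fin ?powR_ge0 ?kerk_ge0.
  + exact: kerN_ge0.
Qed.

End Existence.

Theorem theorem1p1 (R : realType) (N : nat) (k p : R)
  (mu : {measure set (pt R N) -> \bar R}) :
  (3 <= N)%N -> 0 < k -> k < (N.-1)%:R -> 0 < p ->
  mu setT <> 0%E ->
  locally_finite mu ->
  (forall x, in_support mu x -> 0 < x.2) ->
  (forall x, (Upot mu x < +oo)%E) ->
  [/\
   (* (i) *)
   ((k <= 1) \/ (1 < k /\ p < (N.-1)%:R / (k - 1))) ->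
     forall lam : R, 0 < lam -> ~ exists u ut, positive_solution k p lam mu u ut,
   (* (ii) *)
   (1 < k -> p = (N.-1)%:R / (k - 1) ->
     forall lam : R, 0 < lam -> ~ exists u ut, positive_solution k p lam mu u ut /\
        (tint (fun x => (`|ut x| `^ p)%:E) < +oo)%E) &
   (* (iii) *)
   (1 < k -> (N.-1)%:R / (k - 1) < p ->
     (exists C : R, 0 < C /\ ae_RN (fun x => (Upot mu x <= (C * (1 + pnorm x) `^ (1 - k))%:E)%E)) ->
     exists lstar : R, 0 < lstar /\
       forall lam : R, 0 < lam -> lam < lstar ->
         exists u ut, positive_solution k p lam mu u ut /\
           exists gam : R, 0 < gam /\ gam < 1 /\
             exists w : pt R N -> R, holder_closed_half gam w /\
               forall x : pt R N, 0 < x.2 ->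
                 (u x)%:E = (\int[mu]_(y in @halfspace R N) Green x y + (w x)%:E)%E)].
Proof.
move=> N3 k0 kn p0 mu0 muf supp Ufin; split.
- move=> hk lam lam0.
  exact: (no_positive_solution N mu k p lam N3 k0 kn p0 lam0 mu0 supp hk).
- move=> k1 pk lam lam0.
  exact: (no_Lp_solution N mu k p lam N3 k0 kn p0 lam0 mu0 supp k1 pk).
- move=> k1 pk Udecay.
  exact: (small_lambda_solution N mu k p N3 k1 kn p0 pk mu0 muf supp Ufin Udecay).
Qed.
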